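(* Let $\Gamma^J=SL_2(\mathbb Z)\ltimes\mathbb Z^2$ be the full Jacobi group (pairs $(M,X)$, $M\in SL_2(\mathbb Z)$, $X\in\mathbb Z^2$ a row vector, with $(M,X)(M',X')=(MM',XM'+X')$). With trivial integer coefficients, $$H_1(\Gamma^J)\cong\mathbb Z_{12},\quad H_2(\Gamma^J)\cong\mathbb Z\oplus\mathbb Z_2,\quad H^1(\Gamma^J)\cong0,\quad H^2(\Gamma^J)\cong\mathbb Z\oplus\mathbb Z_{12},\quad H^3(\Gamma^J)\cong\mathbb Z_2.$$ *)

(* Defs.v *)
From HB Require Import structures.
From mathcomp Require Import all_boot all_order all_algebra.
From mathcomp Require Import freeg.

Set Implicit Arguments.
Unset Strict Implicit.
Unset Printing Implicit Defensive.

Import Order.TTheory GRing.Theory Num.Theory.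
Local Open Scope ring_scope.

Definition jacobi_carrier := ('M[int]_2 * 'rV[int]_2)%type.

Definition jacobi_pred : pred jacobi_carrier := fun p => \det p.1 == 1.

Definition GJ := {p : jacobi_carrier | jacobi_pred p}.

Definition jacobi_mul_raw (p q : jacobi_carrier) : jacobi_carrier :=
  (p.1 *m q.1, p.2 *m q.1 + q.2).

Lemma jacobi_mul_proof (a b : GJ) : jacobi_pred (jacobi_mul_raw (val a) (val b)).
Proof.
case: a => [[M X] /= /eqP hM]; case: b => [[N Y] /= /eqP hN].
by rewrite /jacobi_pred /= det_mulmx hM hN mulr1.
Qed.

Definition jmul (a b : GJ) : GJ := exist jacobi_pred _ (jacobi_mul_proof a b).

Lemma jacobi_one_proof : jacobi_pred (1%:M, 0).
Proof. by rewrite /jacobi_pred /= det1. Qed.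

Definition jone : GJ := exist jacobi_pred _ jacobi_one_proof.

(* Inhomogeneous bar complex (trivial coefficients Z).                   *)

Definition face (s : seq GJ) (i : nat) : seq GJ :=
  if i == 0%N then behead s
  else if i == size s then take i.-1 s
  else take i.-1 s ++ jmul (nth jone s i.-1) (nth jone s i) :: drop i.+1 s.

Definition word := seq GJ.
Definition chain := {freeg word / int}.

Definition bd_gen (s : seq GJ) : chain :=
  if s is [::] then 0
  else \sum_(i < (size s).+1) (-1) ^+ i *: << face s i >>.

Definition bd (c : chain) : chain := fglift bd_gen c.

Definition chain_deg (n : nat) (c : chain) : Prop :=
  forall s, coeff s c != 0 -> size s = n.

Definition is_cycle (n : nat) (c : chain) : Prop := chain_deg n c /\ bd c = 0.

Definition is_boundary (n : nat) (c : chain) : Prop :=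
  exists d, chain_deg n.+1 d /\ c = bd d.

(* H_n(Gamma^J; Z) is isomorphic to A : there is a homomorphism from the
   n-cycles onto A whose kernel is exactly the n-boundaries. *)
Definition homology_iso (n : nat) (A : zmodType) : Prop :=
  exists phi : chain -> A,
    (forall c d, is_cycle n c -> is_cycle n d -> phi (c - d) = phi c - phi d) /\
    (forall a, exists c, is_cycle n c /\ phi c = a) /\
    (forall c, is_cycle n c -> (phi c = 0 <-> is_boundary n c)).

Definition cochain (n : nat) := n.-tuple GJ -> int.

Definition ev (n : nat) (f : cochain n) (s : seq GJ) : int :=
  match insub s with Some t => f t | None => 0 end.

Definition cobd (n : nat) (f : cochain n) : cochain n.+1 :=
  fun t => \sum_(i < n.+2) (-1) ^+ i * ev f (face t i).

Definition is_cocycle (n : nat) (f : cochain n) : Prop :=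
  forall t, cobd f t = 0.

Definition is_coboundary (n : nat) (f : cochain n.+1) : Prop :=
  exists g : cochain n, forall t, f t = cobd g t.

Definition is_coboundary_deg (n : nat) : cochain n -> Prop :=
  match n with
  | 0%N => fun f => forall t, f t = 0
  | m.+1 => @is_coboundary m
  end.

Definition cohomology_iso (n : nat) (A : zmodType) : Prop :=
  exists phi : cochain n -> A,
    (forall f g, is_cocycle f -> is_cocycle g ->
       phi (fun t => f t - g t) = phi f - phi g) /\
    (forall a, exists f, is_cocycle f /\ phi f = a) /\
    (forall f, is_cocycle f -> (phi f = 0 <-> is_coboundary_deg f)).

Definition cohomology_trivial (n : nat) : Prop :=
  forall f : cochain n, is_cocycle f -> is_coboundary_deg f.

(* Main.v *)
(* Let G be the Jacobi group. It is generated by S and U in SL_2(Z), of orders 4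
   and 6, and by two translations X and Y; the relations S^4 = 1, S^2 = U^3,
   XY = YX, X^S = Y, Y^S = X^-1, X^U = Y, Y^U = X^-1 Y present it.

   A 2-cocycle is a coboundary exactly when these relations lift to the extension
   it defines. For trivial coefficients the obstructions are the values on the
   cycles c = [X|Y] - [Y|X] and d = [X|S] - [S|Y] - [X|U] + [U|Y], where 2d is
   always a boundary, and a class in Z/12 coming from S^4 = 1 and S^2 = U^3.
   They are all realised: c is detected by the integral Heisenberg group, which
   admits an action of SL_2(Z), d by a cup product mod 2, and Z/12 by the Bockstein
   of G -> Z/12. This settles degrees 1 and 2, homology being treated with the
   universal cocycle (g, h) |-> [g|h].

   In degree 3 the key point is H^3(G; Q) = 0. Dimension shifting turns a rational
   3-cocycle into an extension of G by the module of functions G -> Q modulo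
   constants. It splits over Z^2:Z/4 and over Z^2:Z/6, which are triangle groups;
   these two subgroups generate G amalgamated along Z^2:Z/2, and the two splittings
   can be made to agree on the intersection because the only obstruction, in
   H^2(Z^2; Q) = Q, is removed by the Heisenberg class. Hence an integral 3-cocycle
   is the coboundary of a rational 2-cochain b, which may be chosen with b(c) = 0,
   and its class is the integer 2 b(d) modulo 2. *)

Require Import Defs.
From HB Require Import structures.
From mathcomp Require Import all_boot all_order all_algebra.
From mathcomp Require Import freeg.
From mathcomp Require Import boolp functions.
From mathcomp Require Import zify ring lra.

Set Implicit Arguments.
Unset Strict Implicit.
Unset Printing Implicit Defensive.

Import Order.TTheory GRing.Theory Num.Theory.
Local Open Scope ring_scope.

(** * The group and its generators *)

Definition ja (g : GJ) : int := (val g).1 0 0.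
Definition jb (g : GJ) : int := (val g).1 0 1.
Definition jc (g : GJ) : int := (val g).1 1 0.
Definition jd (g : GJ) : int := (val g).1 1 1.
Definition jv (g : GJ) : int := (val g).2 0 0.
Definition jw (g : GJ) : int := (val g).2 0 1.

Lemma det_mx22 (A : 'M[int]_2) : \det A = A 0 0 * A 1 1 - A 0 1 * A 1 0.
Proof.
have e1 : fintype.lift (0 : 'I_2) (0 : 'I_1) = 1 by apply: val_inj.
have e2 : fintype.lift (1 : 'I_2) (0 : 'I_1) = 0 by apply: val_inj.
rewrite (expand_det_row _ 0) !big_ord_recl big_ord0 addr0 !e1 /cofactor !det_mx11 !mxE.
by rewrite !e1 !e2 /=; ring.
Qed.

Lemma det_jacobi (g : GJ) : ja g * jd g - jb g * jc g = 1.
Proof. by have /eqP := valP g; rewrite det_mx22. Qed.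

Lemma jacobi_ext (g h : GJ) : ja g = ja h -> jb g = jb h -> jc g = jc h ->
  jd g = jd h -> jv g = jv h -> jw g = jw h -> g = h.
Proof.
have ord2P (i : 'I_2) : i = 0 \/ i = 1.
  by case: i => [[|[|//]]] ?; [left|right]; apply: val_inj.
case: g => [[M X] hM]; case: h => [[N Y] hN].
rewrite /ja /jb /jc /jd /jv /jw /= => h1 h2 h3 h4 h5 h6.
apply: val_inj; congr pair; apply/matrixP => i j; rewrite ?(ord1 i).
  by case: (ord2P i) => ->; case: (ord2P j) => ->.
by case: (ord2P j) => ->.
Qed.

Definition jmx (a b c d v w : int) : jacobi_carrier :=
  (\matrix_(i < 2, j < 2) (if i == 0 then if j == 0 then a else b
                           else if j == 0 then c else d),
   \row_(j < 2) (if j == 0 then v else w)).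

Lemma jmx_proof a b c d v w : a * d - b * c = 1 -> jacobi_pred (jmx a b c d v w).
Proof. by move=> h; rewrite /jacobi_pred det_mx22 !mxE /= h. Qed.

Definition mkJ a b c d v w h : GJ := exist jacobi_pred _ (@jmx_proof a b c d v w h).

Lemma mkJE a b c d v w h : let g := @mkJ a b c d v w h in
  (ja g = a) * (jb g = b) * (jc g = c) * (jd g = d) * (jv g = v) * (jw g = w).
Proof. by rewrite /ja /jb /jc /jd /jv /jw /= !mxE. Qed.

Lemma jmul_coord (g h : GJ) :
  (ja (jmul g h) = ja g * ja h + jb g * jc h) *
  (jb (jmul g h) = ja g * jb h + jb g * jd h) *
  (jc (jmul g h) = jc g * ja h + jd g * jc h) *
  (jd (jmul g h) = jc g * jb h + jd g * jd h) *
  (jv (jmul g h) = jv g * ja h + jw g * jc h + jv h) *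
  (jw (jmul g h) = jv g * jb h + jw g * jd h + jw h).
Proof.
have e1 : fintype.lift (0 : 'I_2) (0 : 'I_1) = 1 by apply: val_inj.
by rewrite /ja /jb /jc /jd /jv /jw /= !mxE !big_ord_recl !big_ord0 !addr0 !e1.
Qed.

Lemma jone_coord : (ja jone = 1) * (jb jone = 0) * (jc jone = 0) * (jd jone = 1) *
  (jv jone = 0) * (jw jone = 0).
Proof. by rewrite /ja /jb /jc /jd /jv /jw /= !mxE. Qed.

Lemma jinv_det (g : GJ) : jd g * ja g - (- jb g) * (- jc g) = 1.
Proof. by rewrite -(det_jacobi g); ring. Qed.

Definition jinv (g : GJ) : GJ :=
  @mkJ (jd g) (- jb g) (- jc g) (ja g)
    (- (jv g * jd g - jw g * jc g)) (jv g * jb g - jw g * ja g) (jinv_det g).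

Lemma jmulA : associative jmul.
Proof. by move=> g h k; apply: jacobi_ext; rewrite !jmul_coord; ring. Qed.

Lemma jmul1g : left_id jone jmul.
Proof. by move=> g; apply: jacobi_ext; rewrite !jmul_coord !jone_coord; ring. Qed.

Lemma jmulg1 : right_id jone jmul.
Proof. by move=> g; apply: jacobi_ext; rewrite !jmul_coord !jone_coord; ring. Qed.

Lemma jmulVg : left_inverse jone jinv jmul.
Proof.
move=> g; have dg := det_jacobi g.
apply: jacobi_ext; rewrite !jmul_coord !jone_coord !mkJE; try ring;
  try (by rewrite -[in RHS]dg; ring).
- transitivity (jv g * (1 - (ja g * jd g - jb g * jc g))); first by ring.
  by rewrite dg; ring.
- transitivity (jw g * (1 - (ja g * jd g - jb g * jc g))); first by ring.
  by rewrite dg; ring.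
Qed.

Lemma jmulgV : right_inverse jone jinv jmul.
Proof.
move=> g; have dg := det_jacobi g.
by apply: jacobi_ext; rewrite !jmul_coord !jone_coord !mkJE; try ring;
  rewrite -[in RHS]dg; ring.
Qed.

HB.instance Definition _ := Choice.copy GJ {p : jacobi_carrier | jacobi_pred p}.
HB.instance Definition _ :=
  isGroup.Build GJ jmulA jmul1g jmulg1 jmulVg jmulgV.

Lemma mulg_coord (g h : GJ) :
  (ja (g * h)%g = ja g * ja h + jb g * jc h) *
  (jb (g * h)%g = ja g * jb h + jb g * jd h) *
  (jc (g * h)%g = jc g * ja h + jd g * jc h) *
  (jd (g * h)%g = jc g * jb h + jd g * jd h) *
  (jv (g * h)%g = jv g * ja h + jw g * jc h + jv h) *
  (jw (g * h)%g = jv g * jb h + jw g * jd h + jw h).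
Proof. exact: jmul_coord. Qed.

Lemma oneg_coord : (ja 1%g = 1) * (jb 1%g = 0) * (jc 1%g = 0) * (jd 1%g = 1) *
  (jv 1%g = 0) * (jw 1%g = 0).
Proof. exact: jone_coord. Qed.

Definition jS : GJ := @mkJ 0 1 (-1) 0 0 0 erefl.
Definition jU : GJ := @mkJ 0 1 (-1) 1 0 0 erefl.
Lemma transl_det : (1 : int) * 1 - 0 * 0 = 1. Proof. by []. Qed.
Definition transl (v w : int) : GJ := @mkJ 1 0 0 1 v w transl_det.
Definition jX : GJ := transl 1 0.
Definition jY : GJ := transl 0 1.

Definition jcoord := (mulg_coord, oneg_coord, mkJE).

Lemma jS2E : (jS ^+ 2)%g = @mkJ (-1) 0 0 (-1) 0 0 erefl.
Proof. by rewrite expgS expg1; apply: jacobi_ext; rewrite !jcoord. Qed.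
Lemma jS3E : (jS ^+ 3)%g = @mkJ 0 (-1) 1 0 0 0 erefl.
Proof. by rewrite expgS jS2E; apply: jacobi_ext; rewrite !jcoord. Qed.
Lemma jS4 : (jS ^+ 4 = 1)%g.
Proof. by rewrite expgS jS3E; apply: jacobi_ext; rewrite !jcoord. Qed.
Lemma jU2E : (jU ^+ 2)%g = @mkJ (-1) 1 (-1) 0 0 0 erefl.
Proof. by rewrite expgS expg1; apply: jacobi_ext; rewrite !jcoord. Qed.
Lemma jU3E : (jU ^+ 3)%g = @mkJ (-1) 0 0 (-1) 0 0 erefl.
Proof. by rewrite expgS jU2E; apply: jacobi_ext; rewrite !jcoord. Qed.
Lemma jU4E : (jU ^+ 4)%g = @mkJ 0 (-1) 1 (-1) 0 0 erefl.
Proof. by rewrite expgS jU3E; apply: jacobi_ext; rewrite !jcoord. Qed.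
Lemma jU5E : (jU ^+ 5)%g = @mkJ 1 (-1) 1 0 0 0 erefl.
Proof. by rewrite expgS jU4E; apply: jacobi_ext; rewrite !jcoord. Qed.
Lemma jS2U3 : (jS ^+ 2 = jU ^+ 3)%g.
Proof. by rewrite jS2E jU3E; apply: jacobi_ext; rewrite !jcoord. Qed.
Lemma jXY : (jX * jY = jY * jX)%g.
Proof. by apply: jacobi_ext; rewrite !jcoord. Qed.
Lemma jXS : (jX * jS = jS * jY)%g.
Proof. by apply: jacobi_ext; rewrite !jcoord. Qed.
Lemma jXV : (jX^-1 = transl (-1) 0)%g.
Proof.
by apply: (mulgI jX); rewrite mulgV; apply: jacobi_ext; rewrite !jcoord.
Qed.
Lemma jYS : (jY * jS = jS * jX^-1)%g.
Proof. by rewrite jXV; apply: jacobi_ext; rewrite !jcoord. Qed.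
Lemma jXU : (jX * jU = jU * jY)%g.
Proof. by apply: jacobi_ext; rewrite !jcoord. Qed.
Lemma jYU : (jY * jU = jU * (jX^-1 * jY))%g.
Proof. by rewrite jXV; apply: jacobi_ext; rewrite !jcoord. Qed.

(** * Generation of the group by S, U and X *)

Section Generation.
Variable P : GJ -> Prop.
Hypothesis Pmul : forall g h, P g -> P h -> P (g * h)%g.
Hypothesis PS : P jS.
Hypothesis PU : P jU.

Let P1 : P 1%g.
Proof. by rewrite -jS4 !expgS expg0 mulg1; do !apply: Pmul. Qed.

Let Pexp n (g : GJ) : P g -> P (g ^+ n)%g.
Proof. by move=> Pg; elim: n => [|n IH]; rewrite ?expg0 // expgS; apply: Pmul. Qed.

Let Pright (g h k : GJ) : (h * k = 1)%g -> P k -> P (g * h)%g -> P g.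
Proof. by move=> hk Pk Pgh; rewrite -(mulg1 g) -hk mulgA; apply: Pmul. Qed.

Let upper_det (n : int) : 1 * 1 - n * 0 = 1. Proof. by ring. Qed.
Let lower_det (n : int) : 1 * 1 - 0 * n = 1. Proof. by ring. Qed.
Let upper (n : int) := @mkJ 1 n 0 1 0 0 (upper_det n).
Let lower (n : int) := @mkJ 1 0 n 1 0 0 (lower_det n).

Let upperD (m n : int) : upper (m + n) = (upper m * upper n)%g.
Proof. by apply: jacobi_ext; rewrite !jcoord; ring. Qed.
Let lowerD (m n : int) : lower (m + n) = (lower m * lower n)%g.
Proof. by apply: jacobi_ext; rewrite !jcoord; ring. Qed.
Let upper0 : upper 0 = 1%g. Proof. by apply: jacobi_ext; rewrite !jcoord. Qed.
Let lower0 : lower 0 = 1%g. Proof. by apply: jacobi_ext; rewrite !jcoord. Qed.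

Let Pupper (n : int) : P (upper n).
Proof.
have Pm : P (upper (-1)).
  suff -> : upper (-1) = (jS ^+ 3 * jU)%g by apply: Pmul => //; apply: Pexp.
  by apply: jacobi_ext; rewrite ?(jS2E, jS3E, jU2E, jU4E, jU5E) !jcoord.
have Pp : P (upper 1).
  suff -> : upper 1 = (jU ^+ 5 * jS)%g by apply: Pmul => //; apply: Pexp.
  by apply: jacobi_ext; rewrite ?(jS2E, jS3E, jU2E, jU4E, jU5E) !jcoord.
elim: n => [|n IH|n IH]; first by rewrite upper0.
  by rewrite intS upperD; apply: Pmul.
by rewrite intS opprD upperD; apply: Pmul.
Qed.

Let Plower (n : int) : P (lower n).
Proof.
have Pm : P (lower (-1)).
  suff -> : lower (-1) = (jS ^+ 3 * jU ^+ 2)%g by apply: Pmul; apply: Pexp.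
  by apply: jacobi_ext; rewrite ?(jS2E, jS3E, jU2E, jU4E, jU5E) !jcoord.
have Pp : P (lower 1).
  suff -> : lower 1 = (jU ^+ 4 * jS)%g by apply: Pmul => //; apply: Pexp.
  by apply: jacobi_ext; rewrite ?(jS2E, jS3E, jU2E, jU4E, jU5E) !jcoord.
elim: n => [|n IH|n IH]; first by rewrite lower0.
  by rewrite intS lowerD; apply: Pmul.
by rewrite intS opprD lowerD; apply: Pmul.
Qed.

(** Euclidean algorithm on the first row: right multiplication by elementary matrices, which are
    words in S and U, lowers [|a| + |b|] until an entry vanishes; with [b = 0] the matrix is lower
    triangular up to the sign [S^2]. *)
Lemma jacobi_linear_ind g : jv g = 0 -> jw g = 0 -> P g.
Proof.
have base h : jv h = 0 -> jw h = 0 -> jb h = 0 -> P h.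
  move=> hv hw hb; have dh := det_jacobi h.
  have [[ha hd]|[ha hd]] : (ja h = 1 /\ jd h = 1) \/ (ja h = -1 /\ jd h = -1).
    move: dh; rewrite hb mul0r subr0 => dh.
    have := congr1 absz dh; rewrite abszM => /eqP; rewrite muln_eq1 => /andP[/eqP a1 _].
    have [ha|ha] : ja h = 1 \/ ja h = -1 by lia.
      by left; rewrite ha mul1r in dh.
    by right; move: dh; rewrite ha mulN1r => /(congr1 -%R); rewrite opprK.
  - suff -> : h = lower (jc h) by [].
    by apply: jacobi_ext; rewrite !jcoord.
  - suff -> : h = (jS ^+ 2 * lower (- jc h))%g by apply: Pmul => //; apply: Pexp.
    apply: jacobi_ext; rewrite ?(jS2E, jS3E, jU2E, jU4E, jU5E) !jcoord ?ha ?hb ?hd ?hv ?hw; ring.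
have [n] := ubnP (`|ja g| + `|jb g|)%N.
elim: n => // n IH in g * => le_n gv gw.
have [gb|gb] := eqVneq (jb g) 0; first exact: base.
have [ga|ga] := eqVneq (ja g) 0.
  apply: (@Pright g jS (jS ^+ 3)%g); [by rewrite -expgS jS4 | exact: Pexp |].
  by apply: base; rewrite !jcoord ?ga ?gv ?gw; ring.
have U m : (upper m * upper (- m) = 1)%g by rewrite -upperD subrr.
have L m : (lower m * lower (- m) = 1)%g by rewrite -lowerD subrr.
(* The sign is chosen so that adding [m] times the smaller entry to the larger one lowers the
   absolute value of the latter. *)
pose m : int := if (0 < ja g) == (0 < jb g) then -1 else 1.
have [ab|ab] := leP `|ja g|%N `|jb g|%N.
  apply: (Pright (U m) (Pupper _)); apply: IH; rewrite !jcoord ?gv ?gw ?mul0r //.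
  by move: le_n; rewrite /m; case: ifP; lia.
apply: (Pright (L m) (Plower _)); apply: IH; rewrite !jcoord ?gv ?gw ?mul0r //.
by move: le_n; rewrite /m; case: ifP; lia.
Qed.

Hypothesis PX : P jX.

Lemma jacobi_ind g : P g.
Proof.
(* [P] is closed under products only, so Y and the inverse translations are obtained by conjugating
   with powers of S, where [S^3] serves as the inverse of S. *)
have PY : P jY.
  suff -> : jY = (jS ^+ 3 * jX * jS)%g by do !apply: Pmul => //; apply: Pexp.
  by apply: jacobi_ext; rewrite ?(jS2E, jS3E, jU2E, jU4E, jU5E) !jcoord.
have PXV : P (transl (-1) 0).
  suff -> : transl (-1) 0 = (jS ^+ 2 * jX * jS ^+ 2)%g
    by do !apply: Pmul => //; apply: Pexp.
  by apply: jacobi_ext; rewrite ?(jS2E, jS3E, jU2E, jU4E, jU5E) !jcoord.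
have PYV : P (transl 0 (-1)).
  suff -> : transl 0 (-1) = (jS ^+ 2 * jY * jS ^+ 2)%g
    by do !apply: Pmul => //; apply: Pexp.
  by apply: jacobi_ext; rewrite ?(jS2E, jS3E, jU2E, jU4E, jU5E) !jcoord.
have trD v w v' w' : transl (v + v') (w + w') = (transl v w * transl v' w')%g.
  by apply: jacobi_ext; rewrite !jcoord; ring.
have P0 : P (transl 0 0).
  suff -> : transl 0 0 = 1%g by [].
  by apply: jacobi_ext; rewrite !jcoord.
have Pv v : P (transl v 0).
  elim: v => [|n IH|n IH] //.
    by rewrite intS -[X in transl _ X]addr0 trD; apply: Pmul.
  by rewrite intS opprD -[X in transl _ X]addr0 trD; apply: Pmul.
have Pw w : P (transl 0 w).
  elim: w => [|n IH|n IH] //.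
    by rewrite intS -[X in transl X _]addr0 trD; apply: Pmul.
  by rewrite intS opprD -[X in transl X _]addr0 trD; apply: Pmul.
have dg : ja g * jd g - jb g * jc g = 1 := det_jacobi g.
suff -> : g = (mkJ 0 0 dg * (transl (jv g) 0 * transl 0 (jw g)))%g.
  by apply: Pmul; [apply: jacobi_linear_ind; rewrite !jcoord | apply: Pmul].
by apply: jacobi_ext; rewrite !jcoord; ring.
Qed.

End Generation.

(** * The presentation *)

Definition zexpg (E : groupType) (x : E) (n : int) : E :=
  match n with Posz n => (x ^+ n)%g | Negz n => (x ^- n.+1)%g end.

Section IntegerPowers.
Local Open Scope group_scope.
Variable E : groupType.
Implicit Types x y z : E.

Lemma zexpg1 x : zexpg x 1 = x. Proof. by []. Qed.
Lemma zexpgN x (n : int) : zexpg x (- n)%R = (zexpg x n)^-1.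
Proof. by case: n => [[|n]|n] //=; rewrite ?invg1 // invgK. Qed.

Let zexpgS x (n : int) : zexpg x (1 + n)%R = x * zexpg x n.
Proof.
case: n => [n|[|n]]; first by rewrite -intS /= expgS.
  by rewrite /= expg1 mulgV.
suff -> : (1 + Negz n.+1)%R = Negz n by rewrite /= (expgSr _ n.+1) invgM mulVKg.
by rewrite !NegzE; lia.
Qed.

Lemma zexpgD x (m n : int) : zexpg x (m + n)%R = zexpg x m * zexpg x n.
Proof.
elim: m n => [|m IH|m IH] n; first by rewrite add0r mul1g.
  by rewrite intS -addrA !zexpgS IH mulgA.
have {}IH k : zexpg x (- (m%:Z) + k)%R = zexpg x (- (m%:Z))%R * zexpg x k by [].
have -> : (- (m.+1%:Z) + n = - m%:Z + (n - 1))%R by lia.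
have -> : (- (m.+1%:Z) = - m%:Z + - (1%:Z))%R by lia.
rewrite !IH -mulgA; congr (_ * _); rewrite zexpgN zexpg1.
by rewrite -[in RHS](subrKC 1%R n) zexpgS mulKg.
Qed.

Lemma zexpgJ x z (n : int) : zexpg x n ^ z = zexpg (x ^ z) n.
Proof. by case: n => n /=; rewrite ?conjVg conjXg. Qed.

Lemma commute_zexpg x y (n : int) : commute x y -> commute x (zexpg y n).
Proof. by case: n => n /= c; [|apply: commuteV]; apply: commuteX. Qed.

End IntegerPowers.

(** * Normal forms for words in generators with s^4 = 1 and s^2 = u^3 *)

Section Words.
Local Open Scope group_scope.
Variables (E : groupType) (s u : E).

Definition evw (w : seq bool) : E :=
  foldl (fun e b => e * (if b then s else u)) 1 w.

Let evw_from e w : foldl (fun e b => e * (if b then s else u)) e w = e * evw w.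
Proof.
rewrite /evw; elim: w e => [|b w IH] e /=; first by rewrite mulg1.
by rewrite IH [in RHS]IH mul1g mulgA.
Qed.

Lemma evw_cons b w : evw (b :: w) = (if b then s else u) * evw w.
Proof. by rewrite /evw /= evw_from mul1g. Qed.

Lemma evw_cat w1 w2 : evw (w1 ++ w2) = evw w1 * evw w2.
Proof. by rewrite /evw foldl_cat evw_from. Qed.

Lemma evw_rcons w b : evw (rcons w b) = evw w * (if b then s else u).
Proof. by rewrite -cats1 evw_cat evw_cons mulg1. Qed.

Hypothesis s4 : s ^+ 4 = 1.
Hypothesis s2u3 : s ^+ 2 = u ^+ 3.

(** Words contain no inverse letters; the relations give [s^-1 = s^3] and [u^-1 = u^5]. *)
Definition invw (w : seq bool) : seq bool :=
  flatten [seq if b then nseq 3 true else nseq 5 false | b <- rev w].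

Lemma evw_inv w : evw (invw w) = (evw w)^-1.
Proof.
have s3 : s ^+ 3 = s^-1 by apply/esym/mulg1_eq; rewrite -expgS.
have u5 : u ^+ 5 = u^-1.
  by apply/esym/mulg1_eq; rewrite -expgS (expgnA u 3 2) -s2u3 -expgnA.
elim: w => [|b w IH]; first by rewrite /evw /= invg1.
rewrite evw_cons invgM -IH /invw rev_cons map_rcons flatten_rcons evw_cat.
by congr (_ * _); case: b; rewrite -?s3 -?u5 !evw_cons /evw /= !expgS expg0.
Qed.

(* A code [(e, i, p, j)] stands for the normal form [s^(2e) u^i p s^j], where [p]
   is a word, stored backwards, in [s^3 u] (false) and [s^3 u^2] (true). *)
Definition code := (bool * nat * seq bool * bool)%type.

Fixpoint evp (p : seq bool) : E :=
  if p is b :: q then evp q * (s ^+ 3 * (if b then u ^+ 2 else u)) else 1.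

Definition evcode (c : code) : E :=
  let: (e, i, p, j) := c in s ^+ (2 * e) * u ^+ i * evp p * s ^+ j.

(** Right multiplication of a normal form by [s] (true) or [u] (false). The central element
    [s^2 = u^3] moves to the front and toggles [e]; the other cases rest on [s u = s^2 (s^3 u)] and
    [s^3 u^2 u = s]. *)
Definition step (c : code) (b : bool) : code :=
  let: (e, i, p, j) := c in
  if b then (if j then (~~ e, i, p, false) else (e, i, p, true))
  else if j then (~~ e, i, false :: p, false)
  else match p with
       | [::] => if (i < 2)%N then (e, i.+1, [::], false) else (~~ e, 0, [::], false)
       | false :: q => (e, i, true :: q, false)
       | true :: q => (e, i, q, true)
       end.

Definition code_ok (c : code) := (c.1.1.2 < 3)%N.

Lemma step_ok c b : code_ok c -> code_ok (step c b).
Proof.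
by case: c => [[[e i] [|[] p]] []]; case: b; rewrite /code_ok //=; case: ifP.
Qed.

Lemma evcode_step c b : code_ok c ->
  evcode (step c b) = evcode c * (if b then s else u).
Proof.
have csu : commute u (s ^+ 2) by rewrite s2u3; apply: commuteX.
have css : commute s (s ^+ 2) by apply: commuteX.
have ce p : commute (s ^+ 2) (evp p).
  elim: p => [|a p IH]; first exact: commute1.
  apply: (commuteM IH); apply: commuteM; first exact: commuteX2.
  by case: a; [apply: commuteX|]; exact/commute_sym.
have flip (e : bool) t : s ^+ (2 * ~~ e) * t = s ^+ (2 * e) * (s ^+ 2 * t).
  case: e; rewrite /= ?muln0 ?muln1 ?expg0 ?mul1g //.
  by rewrite mulgA -expgnDr s4 mul1g.
have mvp p t : evp p * (s ^+ 2 * t) = s ^+ 2 * (evp p * t).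
  by rewrite mulgA -(ce p) -mulgA.
have mvu i t : u ^+ i * (s ^+ 2 * t) = s ^+ 2 * (u ^+ i * t).
  have cui : commute (u ^+ i) (s ^+ 2) by exact/commute_sym/commuteX/commute_sym.
  by rewrite mulgA cui -mulgA.
have s5 t : s ^+ 2 * (s ^+ 3 * t) = s * t.
  by rewrite mulgA -expgnDr (expgnDr s 4 1) s4 mul1g.
have u3 t : u ^+ 2 * (u * t) = s ^+ 2 * t by rewrite s2u3 (expgSr u 2) mulgA.
have ss : s * s = s ^+ 2 by [].
have uuu : u ^+ 2 * u = s ^+ 2 by rewrite s2u3 -expgSr.
have s32 : s ^+ 3 * s ^+ 2 = s by rewrite -expgnDr (expgnDr s 4 1) s4 mul1g.
have uu : u * u = u ^+ 2 by [].
case: c => [[[e i] p] j]; rewrite /code_ok /= => i3.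
move: (flip e) (mvu i) (mvp) (s5) (u3) ss uuu s32 uu.
case: b; case: j => /=; rewrite ?expg0 ?expg1 ?mulg1 //; last case: p => [|[] q] /=;
  rewrite ?expg0 ?expg1 ?mulg1.
- move: (s ^+ (2 * ~~ e)) (s ^+ (2 * e)) (s ^+ 2) (s ^+ 3) (u ^+ 2) (u ^+ i).
  move=> f e' w t v ui flip' mvu' mvp' _ _ ss _ _ _.
  by rewrite -!mulgA flip' ss; have := mvp' p 1; rewrite !mulg1 => ->; rewrite mvu'.
- move: (s ^+ (2 * ~~ e)) (s ^+ (2 * e)) (s ^+ 2) (s ^+ 3) (u ^+ 2) (u ^+ i).
  move=> f e' w t v ui flip' mvu' mvp' s5' _ ss _ _ _.
  by rewrite -!mulgA flip' -mvu' -mvp' s5'.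
- move=> flip' _ _ _ _ _ uuu _ _.
  case: ifP => i2; rewrite /= ?mulg1 ?expg0 ?expgSr ?mulgA //.
  have -> : i = 2 by lia.
  by have := flip' 1; rewrite -(mulgA (s ^+ (2 * e))) uuu !mulg1.
- move: (s ^+ (2 * ~~ e)) (s ^+ (2 * e)) (s ^+ 2) (s ^+ 3) (u ^+ 2) (u ^+ i).
  by move=> f e' w t v ui _ _ _ _ _ _ uuu s32 _; rewrite -!mulgA uuu s32.
- move: (s ^+ (2 * ~~ e)) (s ^+ (2 * e)) (s ^+ 2) (s ^+ 3) (u ^+ 2) (u ^+ i).
  by move=> f e' w t v ui _ _ _ _ _ _ _ _ uu; rewrite -!mulgA uu.
Qed.

Definition code_of (w : seq bool) : code := foldl step (false, 0, [::], false) w.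

Lemma evw_code w : evw w = evcode (code_of w).
Proof.
suff [] : code_ok (code_of w) /\ evw w = evcode (code_of w) by [].
elim/last_ind: w => [|w b [IH1 IH2]]; first by rewrite /= !mulg1.
rewrite /code_of -cats1 foldl_cat /= cats1; split; first exact: step_ok.
by rewrite evw_rcons evcode_step // IH2.
Qed.
End Words.

Lemma code_of_ok w : code_ok (code_of w).
Proof.
elim/last_ind: w => [|w b IH] //.
by rewrite /code_of -cats1 foldl_cat; apply: step_ok.
Qed.

(** For [jS] and [jU] the two letters of [p] are the upper and lower elementary matrices with
    off-diagonal entry -1. Multiplying by them keeps the sign pattern and makes the off-diagonal sum
    negative, so no nonempty [p] yields the identity. *)
Lemma evp_coord p : let g := evp jS jU p in
  [/\ jv g = 0, jw g = 0, 1 <= ja g, 1 <= jd g & jb g <= 0 /\ jc g <= 0]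
  /\ (p != [::] -> jb g + jc g < 0).
Proof.
elim: p => [|b p [[IHv IHw IHa IHd [IHb IHc]] IH]] /=; first by rewrite !jcoord.
case: b; rewrite jS3E ?jU2E !jcoord IHv IHw.
  by split; [split; [ring|ring|lia|lia|split; lia]|lia].
by split; [split; [ring|ring|lia|lia|split; lia]|lia].
Qed.

(** In each of the twelve cases for [e], [i] and [j] the signs from [evp_coord] exclude the identity
    matrix, except in the trivial case, where they force [p] to be empty. *)
Lemma evcode_eq1 c : code_ok c -> evcode jS jU c = 1%g -> c = (false, 0%N, [::], false).
Proof.
case: c => [[[e i] p] j]; rewrite /code_ok /= => i3.
have [[_ _]] := evp_coord p; move: (evp jS jU p) => g ha hd [hb hc] hp eq1.
have := congr1 ja eq1; have := congr1 jb eq1; have := congr1 jc eq1.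
have := congr1 jd eq1.
have {i3} : i \in [:: 0; 1; 2]%N by case: i i3 {eq1} => [|[|[|]]].
have pE : jb g + jc g = 0 -> p = [::].
  by move=> h; apply/eqP; apply: contraT => /hp; rewrite h ltxx.
rewrite !inE => /or3P[] /eqP ->; case: e {eq1}; case: j;
  rewrite ?muln0 ?muln1 ?expg0 ?expg1 ?jS2E ?jU2E ?mul1g ?mulg1 !jcoord;
  move=> *; try (by exfalso; lia); by rewrite pE //; lia.
Qed.

Definition translw (E : groupType) (x y : E) (v w : int) : E :=
  (zexpg x v * zexpg y w)%g.

(** * The universal property of the presentation *)

Section Universal.
Local Open Scope group_scope.
Variables (E : groupType) (s u x y : E).
Hypothesis s4 : s ^+ 4 = 1.
Hypothesis s2u3 : s ^+ 2 = u ^+ 3.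
Hypothesis xy : x * y = y * x.
Hypothesis xs : x * s = s * y.
Hypothesis ys : y * s = s * x^-1.
Hypothesis xu : x * u = u * y.
Hypothesis yu : y * u = u * (x^-1 * y).

Let evG := evw jS jU.
Let evE := evw s u.

Let linear_word (g : GJ) : jv g = 0%R -> jw g = 0%R -> exists w, evG w == g.
Proof.
apply: (@jacobi_linear_ind (fun g => exists w, evG w == g)) => [h k [w1 /eqP <-] [w2 /eqP <-]||].
- by exists (w1 ++ w2); rewrite /evG evw_cat.
- by exists [:: true]; rewrite /evG /evw /= mul1g.
- by exists [:: false]; rewrite /evG /evw /= mul1g.
Qed.

(** The quotient of two words with equal value in the group has trivial normal form, and the
    reduction to normal form uses only the relations on [s] and [u], so it is valid in [E] too. *)
Let evE_eq w w' : evG w = evG w' -> evE w = evE w'.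
Proof.
move=> eqG; have : evG (w ++ invw w') = 1.
  by rewrite /evG evw_cat (evw_inv jS4 jS2U3) -/evG eqG mulgV.
rewrite /evG (evw_code jS4 jS2U3) => /(evcode_eq1 (code_of_ok _)) codeE.
apply/divg1_eq; rewrite -(evw_inv s4 s2u3) -evw_cat (evw_code s4 s2u3) codeE.
by rewrite /= muln0 !expg0 !mulg1.
Qed.

Let tr := translw x y.

Let tr_shift v w v' w' : tr (v + v')%R (w + w')%R = tr v w * tr v' w'.
Proof.
rewrite /tr /translw !zexpgD -!mulgA; congr (_ * _); rewrite !mulgA; congr (_ * _).
by apply: commute_zexpg; apply: commute_sym; apply: commute_zexpg.
Qed.

Let tr_conj e (a b c d : int) : x ^ e = tr a b -> y ^ e = tr c d ->
  forall v w, tr v w * e = e * tr (v * a + w * c)%R (v * b + w * d)%R.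
Proof.
move=> xe ye v w.
have trM v' w' n : zexpg (tr v' w') n = tr (n * v')%R (n * w')%R.
  elim: n => [|n IH|n IH]; first by rewrite !mul0r /tr /translw mulg1.
    by rewrite intS zexpgD zexpg1 IH !mulrDl !mul1r tr_shift.
  rewrite intS opprD zexpgD zexpgN zexpg1 IH !mulrDl !mulN1r tr_shift.
  congr (_ * _); apply/mulg1_eq; rewrite -tr_shift !subrr /tr /translw mulg1 //.
rewrite conjgC {1}/tr /translw conjMg !zexpgJ xe ye !trM -tr_shift.
by [].
Qed.

Let tr_ev w v1 v2 : let g := evG w in tr v1 v2 * evE w =
  evE w * tr (v1 * ja g + v2 * jc g)%R (v1 * jb g + v2 * jd g)%R.
Proof.
rewrite /evG /evE /=; elim/last_ind: w v1 v2 => [|w b IH] v1 v2.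
  by rewrite /evw /= mulg1 mul1g !jcoord !mulr1 !mulr0 addr0 add0r.
rewrite !evw_rcons mulgA IH -[LHS]mulgA -[RHS]mulgA; congr (_ * _).
have trs := @tr_conj s 0 1 (-1) 0.
have tru := @tr_conj u 0 1 (-1) 1.
have xs' : x ^ s = tr 0 1 by rewrite conjgE xs mulKg /tr /translw mul1g.
have ys' : y ^ s = tr (-1) 0 by rewrite conjgE ys mulKg /tr /translw mulg1.
have xu' : x ^ u = tr 0 1 by rewrite conjgE xu mulKg /tr /translw mul1g.
have yu' : y ^ u = tr (-1) 1 by rewrite conjgE yu mulKg.
case: b => /=.
  by rewrite trs //; congr (_ * tr _ _); rewrite !jcoord; ring.
by rewrite tru //; congr (_ * tr _ _); rewrite !jcoord; ring.
Qed.

Let lin (g : GJ) : GJ := @mkJ (ja g) (jb g) (jc g) (jd g) 0 0 (det_jacobi g).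

Let lin_word (g : GJ) : exists w, evG w == lin g.
Proof. by apply: linear_word; rewrite !jcoord. Qed.

Let phi (g : GJ) : E := evE (xchoose (lin_word g)) * tr (jv g) (jw g).

Let phiE w g : evG w = lin g -> phi g = evE w * tr (jv g) (jw g).
Proof.
move=> e; congr (_ * _); apply: evE_eq; rewrite e.
exact/eqP/(xchooseP (lin_word g)).
Qed.

(** A linear part is sent to the value in [E] of any word for it, which [evE_eq] makes independent
    of the word, and a translation to powers of [x] and [y]. Multiplicativity amounts to moving
    translations past words, by [tr_ev]. *)
Theorem jacobi_universal : exists phi : GJ -> E,
  [/\ {morph phi : g h / g * h}, phi jS = s, phi jU = u & phi jX = x /\ phi jY = y].
Proof.
exists phi; split.
- move=> g h.
  have [w /eqP wg] := lin_word g; have [w' /eqP wh] := lin_word h.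
  rewrite (phiE wg) (phiE wh) (@phiE (w ++ w')); last first.
    by rewrite /evG evw_cat -/evG wg wh; apply: jacobi_ext; rewrite !jcoord; ring.
  rewrite /evE evw_cat -/evE [RHS]mulgA -[X in _ = X * _]mulgA tr_ev wh.
  rewrite [X in _ = X * _]mulgA -[RHS]mulgA -tr_shift.
  by congr (_ * _ * tr _ _); rewrite !jcoord; ring.
- rewrite (@phiE [:: true]); last first.
    by rewrite /evG /evw /= mul1g; apply: jacobi_ext; rewrite !jcoord.
  by rewrite !jcoord /evE /evw /= mul1g /tr /translw !mulg1.
- rewrite (@phiE [:: false]); last first.
    by rewrite /evG /evw /= mul1g; apply: jacobi_ext; rewrite !jcoord.
  by rewrite !jcoord /evE /evw /= mul1g /tr /translw !mulg1.
- by split; rewrite (@phiE [::]) ?jcoord /evE /evw /= ?mul1g /tr /translw ?mulg1 ?mul1g //;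
    apply: jacobi_ext; rewrite !jcoord.
Qed.
End Universal.

(** * A decision procedure for abelian groups *)

Inductive zterm := ZTzero | ZTvar of nat | ZTadd of zterm & zterm | ZTopp of zterm
  | ZTmuln of zterm & nat.

Fixpoint zterm_eval (V : zmodType) (env : seq V) (t : zterm) : V :=
  match t with
  | ZTzero => 0
  | ZTvar n => nth 0 env n
  | ZTadd a b => zterm_eval env a + zterm_eval env b
  | ZTopp a => - zterm_eval env a
  | ZTmuln a n => zterm_eval env a *+ n
  end.

Fixpoint zterm_coef (t : zterm) (i : nat) : int :=
  match t with
  | ZTzero => 0
  | ZTvar n => (i == n)%:Z
  | ZTadd a b => zterm_coef a i + zterm_coef b i
  | ZTopp a => - zterm_coef a i
  | ZTmuln a n => zterm_coef a i *+ n
  end.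

Lemma zterm_evalE (V : zmodType) (env : seq V) t :
  zterm_eval env t = \sum_(i < size env) nth 0 env i *~ zterm_coef t i.
Proof.
elim: t => [|n|a IHa b IHb|a IHa|a IHa n] /=.
- by rewrite big1 // => i _; rewrite mulr0z.
- case: (ltnP n (size env)) => hn; last first.
    rewrite nth_default // big1 // => i _.
    by rewrite ltn_eqF ?mulr0z // (leq_trans (ltn_ord i)).
  rewrite (bigD1 (Ordinal hn)) //= eqxx mulr1z big1 ?addr0 // => i.
  by rewrite -val_eqE /= => /negbTE ->; rewrite mulr0z.
- by rewrite IHa IHb -big_split; apply: eq_bigr => i _; rewrite mulrzDr.
- by rewrite IHa -sumrN; apply: eq_bigr => i _; rewrite mulrNz.
- rewrite IHa -sumrMnl; apply: eq_bigr => i _.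
  by rewrite -[X in _ = _ *~ X]mulr_natr mulrzA natz pmulrn.
Qed.

Lemma zterm_eq (V : zmodType) (env : seq V) t1 t2 :
  all (fun i => zterm_coef t1 i == zterm_coef t2 i) (iota 0 (size env)) ->
  zterm_eval env t1 = zterm_eval env t2.
Proof.
move=> /allP h; rewrite !zterm_evalE; apply: eq_bigr => i _.
by rewrite (eqP (h i _)) // mem_iota /=.
Qed.

(* Atoms are compared up to conversion, since structure instances may differ. *)
Ltac zt_index x l :=
  match l with
  | cons ?y _ => let _ := constr:(@erefl _ x : x = y) in constr:(0%N)
  | cons _ ?q => let n := zt_index x q in constr:(S n)
  end.

Ltac zt_add x l :=
  match l with
  | _ => let _ := zt_index x l in l
  | _ => constr:(cons x l)
  end.

Ltac zt_atoms t l :=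
  lazymatch t with
  | 0 => l
  | ?a + ?b => let l' := zt_atoms a l in zt_atoms b l'
  | - ?a => zt_atoms a l
  | ?a *+ ?n => zt_atoms a l
  | _ => zt_add t l
  end.

Ltac zt_reify t l :=
  lazymatch t with
  | 0 => constr:(ZTzero)
  | ?a + ?b => let a' := zt_reify a l in let b' := zt_reify b l in constr:(ZTadd a' b')
  | - ?a => let a' := zt_reify a l in constr:(ZTopp a')
  | ?a *+ ?n => let a' := zt_reify a l in constr:(ZTmuln a' n)
  | _ => let n := zt_index t l in constr:(ZTvar n)
  end.

Ltac zmod :=
  match goal with
  | |- @eq ?V ?a ?b =>
    let l := zt_atoms a (@nil V) in let l' := zt_atoms b l in
    let t1 := zt_reify a l' in let t2 := zt_reify b l' in
    refine (@zterm_eq _ l' t1 t2 _); vm_compute; reflexivity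
  end.

Lemma zmod_from (V : zmodType) (a b c d : V) : c = d -> a - b = c - d -> a = b.
Proof. by move=> ->; rewrite subrr => /subr0_eq. Qed.

(** * Extensions *)

Record cocycle2 (M : zmodType) := Cocycle2 {
  coact : GJ -> M -> M;
  cofun : GJ -> GJ -> M;
  coactD : forall g, {morph coact g : m n / m + n};
  coact1 : forall m, coact 1%g m = m;
  coactM : forall g h m, coact (g * h)%g m = coact g (coact h m);
  cofunP : forall g h k, coact g (cofun h k) + cofun g (h * k)%g =
    cofun (g * h)%g k + cofun g h
}.

Definition extension (M : zmodType) (c : cocycle2 M) := (M * GJ)%type.

Section Extension.
Variables (M : zmodType) (c : cocycle2 M).
Local Notation act := (coact c).
Local Notation f := (cofun c).

Lemma coact0 g : act g 0 = 0.
Proof. by apply: (addrI (act g 0)); rewrite -coactD !addr0. Qed.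
Lemma coactN g m : act g (- m) = - act g m.
Proof. by apply: (addrI (act g m)); rewrite -coactD !subrr coact0. Qed.
Lemma coactB g m n : act g (m - n) = act g m - act g n.
Proof. by rewrite coactD coactN. Qed.
Lemma coactVK g m : act g (act g^-1%g m) = m.
Proof. by rewrite -coactM mulgV coact1. Qed.

Lemma cofun1g g : f 1%g g = f 1%g 1%g.
Proof.
have := cofunP c 1%g 1%g g; rewrite !mul1g coact1 => h.
by apply: (addrI (f 1%g g)).
Qed.
Lemma cofung1 g : f g 1%g = act g (f 1%g 1%g).
Proof.
have := cofunP c g 1%g 1%g; rewrite !mulg1 => h.
by apply: esym (addIr (f g 1%g) h).
Qed.

Definition ext_mul (a b : extension c) : extension c :=
  (a.1 + act a.2 b.1 + f a.2 b.2, (a.2 * b.2)%g).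
(** The cocycle need not be normalized, which accounts for the term [f 1 1] here, in the inverse and
    in the embedding [inker] of the kernel. *)
Definition ext_one : extension c := (- f 1%g 1%g, 1%g).
Definition ext_inv (a : extension c) : extension c :=
  (- f 1%g 1%g - act a.2^-1%g a.1 - f a.2^-1%g a.2, (a.2^-1)%g).

Lemma ext_mulA : associative ext_mul.
Proof.
move=> [m g] [n h] [p k]; rewrite /ext_mul /=; congr pair; last by rewrite mulgA.
rewrite !coactD coactM; apply: (zmod_from (cofunP c g h k)); zmod.
Qed.
Lemma ext_mul1g : left_id ext_one ext_mul.
Proof.
move=> [m g]; rewrite /ext_mul /= coact1 cofun1g mul1g; congr pair; zmod.
Qed.
Lemma ext_mulg1 : right_id ext_one ext_mul.
Proof.
move=> [m g]; rewrite /ext_mul /= coactN (cofung1 g) mulg1; congr pair; zmod.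
Qed.
Lemma ext_mulVg : left_inverse ext_one ext_inv ext_mul.
Proof.
move=> [m g]; rewrite /ext_mul /ext_one /ext_inv /= mulVg; congr pair; zmod.
Qed.
Lemma ext_mulgV : right_inverse ext_one ext_inv ext_mul.
Proof.
move=> [m g]; rewrite /ext_mul /ext_one /ext_inv /= mulgV; congr pair.
rewrite !coactB coactN coactVK.
have := cofunP c g g^-1%g g; rewrite mulVg mulgV cofun1g (cofung1 g) => h.
by apply: (zmod_from (esym h)); zmod.
Qed.
End Extension.

HB.instance Definition _ (M : zmodType) (c : cocycle2 M) :=
  Choice.copy (extension c) (M * GJ)%type.
HB.instance Definition _ (M : zmodType) (c : cocycle2 M) :=
  isGroup.Build (extension c) (@ext_mulA M c) (@ext_mul1g M c) (@ext_mulg1 M c)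
    (@ext_mulVg M c) (@ext_mulgV M c).

Section ExtensionTheory.
Variables (M : zmodType) (c : cocycle2 M).
Local Notation E := (extension c).
Local Notation act := (coact c).
Local Notation f := (cofun c).
Local Open Scope group_scope.

Definition overg (e : E) : GJ := e.2.
Definition inker (m : M) : E := ((m - f 1%g 1%g)%R, 1).

Lemma overgM e e' : overg (e * e') = overg e * overg e'. Proof. by []. Qed.
Lemma overgV e : overg e^-1 = (overg e)^-1. Proof. by []. Qed.
Lemma overgJ e e' : overg (e ^ e') = overg e ^ overg e'. Proof. by []. Qed.
Lemma overg_inker m : overg (inker m) = 1. Proof. by []. Qed.

Lemma inker0 : inker 0 = 1.
Proof. by rewrite /inker add0r. Qed.
Lemma inker_inj : injective inker.
Proof. by move=> m n [] /addIr. Qed.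

Lemma mul_ext (m n : M) (g h : GJ) :
  ((m, g) : E) * (n, h) = ((m + act g n + f g h)%R, g * h).
Proof. by []. Qed.

Lemma inkerM (m : M) (e : E) : inker m * e = ((m + e.1)%R, e.2).
Proof.
case: e => n g; rewrite /inker mul_ext coact1 (cofun1g c g) mul1g /=; congr pair; zmod.
Qed.

Lemma inkerD m n : inker (m + n)%R = inker m * inker n.
Proof. by rewrite inkerM /inker addrA. Qed.
Lemma inkerN m : inker (- m)%R = (inker m)^-1.
Proof. by apply/esym/mulg1_eq; rewrite -inkerD subrr inker0. Qed.

Lemma mul_inker (e : E) m : e * inker m = inker (act (overg e) m) * e.
Proof.
case: e => n g; rewrite /inker !mul_ext coact1 coactB (cofun1g c g) (cofung1 c g) /overg /=.
by rewrite mul1g mulg1; congr pair; zmod.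
Qed.

Lemma inkerJ m (e : E) : inker m ^ e = inker (act (overg e)^-1 m).
Proof.
by apply: (mulgI e); rewrite -conjgC mul_inker -coactM mulgV coact1.
Qed.

Lemma same_over (e e' : E) : overg e = overg e' -> exists m, e = inker m * e'.
Proof.
case: e => m g; case: e' => n h; rewrite /overg /= => ->.
by exists (m - n)%R; rewrite inkerM /= addrNK.
Qed.

(** By [jacobi_universal] such lifts define a homomorphism into the extension. It is a section,
    being one on generators, and its first component is the cochain that trivializes [f]. *)
Theorem extension_split (s u x y : E) :
  overg s = jS -> overg u = jU -> overg x = jX ->
  s ^+ 4 = 1 -> s ^+ 2 = u ^+ 3 -> x * y = y * x ->
  x * s = s * y -> y * s = s * x^-1 -> x * u = u * y -> y * u = u * (x^-1 * y) ->
  exists v : GJ -> M, [/\ forall g h, v (g * h) = (v g + act g (v h) + f g h)%R,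
    v jS = s.1, v jU = u.1 & v jX = x.1].
Proof.
move=> os ou ox s4 su xy xs ys xu yu.
have [phi [phiM phis phiu [phix _]]] := jacobi_universal s4 su xy xs ys xu yu.
have ph g : (phi g).2 = g.
  apply: (@jacobi_ind (fun g => (phi g).2 = g)); rewrite ?phis ?phiu ?phix //.
  by move=> {g} g h eg eh; rewrite phiM -{2}eg -{2}eh.
exists (fun g => (phi g).1); rewrite phis phiu phix; split=> // g h.
by rewrite phiM; case: (phi g) (ph g) => m g' /= ->; case: (phi h) (ph h) => n h' /= ->.
Qed.
End ExtensionTheory.

(** * Trivial coefficients *)

Definition eval_c (A : zmodType) (f : GJ -> GJ -> A) : A := f jX jY - f jY jX.
Definition eval_d (A : zmodType) (f : GJ -> GJ -> A) : A :=
  f jX jS - f jS jY - (f jX jU - f jU jY).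
(** Together with [eval_s4], the kernel elements by which [S^2 = U^3] and [S^4 = 1] fail for the
    lifts of S and U with first component 0. *)
Definition eval_s2u3 (A : zmodType) (f : GJ -> GJ -> A) : A :=
  f jS jS - f jU (jU ^+ 2)%g - f jU jU.
Definition eval_s4 (A : zmodType) (f : GJ -> GJ -> A) : A :=
  f jS (jS ^+ 3)%g + f jS (jS ^+ 2)%g + f jS jS + f 1%g 1%g.

Definition trivial_cocycle (A : zmodType) (f : GJ -> GJ -> A) : Prop :=
  forall g h k, f h k + f g (h * k)%g = f (g * h)%g k + f g h.

(** * Splitting of central extensions *)

Section TrivialCoefficients.
Variables (A : zmodType) (f : GJ -> GJ -> A).
Hypothesis fP : trivial_cocycle f.

Definition triv2 : cocycle2 A :=
  @Cocycle2 A (fun _ m => m) f (fun _ _ _ => erefl) (fun _ => erefl)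
    (fun _ _ _ => erefl) fP.

Local Open Scope group_scope.
Local Notation E := (extension triv2).
Local Notation i := (@inker _ triv2).

Let cen (e : E) m : e * i m = i m * e. Proof. by rewrite mul_inker. Qed.
Let ceM (e e' : E) m n : (i m * e) * (i n * e') = i (m + n)%R * (e * e').
Proof. by rewrite inkerD -!mulgA (mulgA e) cen -!mulgA. Qed.
Let ceV (e : E) m : (i m * e)^-1 = i (- m)%R * e^-1.
Proof. by rewrite invgM -inkerN cen. Qed.
Let ceJ (e e' : E) m : (i m * e) ^ e' = i m * e ^ e'.
Proof. by rewrite conjMg inkerJ. Qed.
Let ceX (e : E) m n : (i m * e) ^+ n = i (m *+ n)%R * e ^+ n.
Proof.
elim: n => [|n IH]; first by rewrite mulr0n inker0 mul1g.
by rewrite !expgS IH ceM mulrS.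
Qed.
Let ceI (e : E) m n : i m * e = i n * e -> m = n.
Proof. by move=> /mulIg/inker_inj. Qed.
Let cD m n (e : E) : i m * (i n * e) = i (m + n)%R * e.
Proof. by rewrite mulgA inkerD. Qed.

Let xt : E := (0%R, jX).
Let yt : E := (0%R, jY).
Let st : E := (0%R, jS).
Let ut : E := (0%R, jU).
(** The lift [y] is adjusted so that [x^s = y] holds exactly; [eval_d f] then measures the failure
    of [x^u = y], and [eval_c f] that of commutation. *)
Let p := (f jX jS - f jS jY)%R.
Let y : E := i p * yt.

Let xs : xt ^ st = y.
Proof.
apply: (mulgI st); rewrite -conjgC /y mulgA cen -mulgA inkerM.
by rewrite /xt /yt /st !mul_ext /= jXS; congr pair; rewrite /p; zmod.
Qed.

Let xu : xt ^ ut = i (- eval_d f)%R * y.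
Proof.
apply: (mulgI ut); rewrite -conjgC /y cD mulgA cen -mulgA inkerM.
by rewrite /xt /yt /ut !mul_ext /= jXU; congr pair; rewrite /p /eval_d; zmod.
Qed.

Let xy : xt * y = i (eval_c f) * (y * xt).
Proof.
rewrite /y mulgA cen -!mulgA (mulgA (i _) (i _)) -inkerD !inkerM.
by rewrite /xt /yt !mul_ext /= jXY; congr pair; rewrite /eval_c; zmod.
Qed.

Let ysE : exists mu, y ^ st = i mu * xt^-1.
Proof.
have eo : overg (y ^ st)%g = overg (xt^-1)%g.
  by rewrite overgJ overgV /y overgM overg_inker mul1g /overg /= conjgE jYS mulKg.
exact: same_over eo.
Qed.

Let yuE : exists la, y ^ ut = i la * (xt^-1 * y).
Proof.
have eo : overg (y ^ ut)%g = overg (xt^-1 * y)%g.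
  by rewrite overgJ !overgM overgV overg_inker !mul1g /overg /= conjgE jYU mulKg.
exact: same_over eo.
Qed.

Let s2u3 : st ^+ 2 = i (eval_s2u3 f) * ut ^+ 3.
Proof.
have -> : st ^+ 2 = (f jS jS, jS ^+ 2).
  by rewrite expg2 /st mul_ext; congr pair; rewrite /=; zmod.
have -> : ut ^+ 3 = ((f jU jU + f jU (jU ^+ 2)%g)%R, jU ^+ 3).
  rewrite (expgS ut 2) (expg2 ut) /ut !mul_ext (expgS jU 2) (expg2 jU); congr pair.
  by rewrite /= !add0r.
by rewrite inkerM /= jS2U3; congr pair; rewrite /eval_s2u3; zmod.
Qed.

Let s4 : st ^+ 4 = i (eval_s4 f).
Proof.
have e2 : st ^+ 2 = (f jS jS, jS ^+ 2).
  by rewrite expg2 /st mul_ext; congr pair; rewrite /= !add0r.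
have e3 : st ^+ 3 = ((f jS jS + f jS (jS ^+ 2)%g)%R, jS ^+ 3).
  by rewrite (expgS st 2) e2 mul_ext (expgS jS 2); congr pair; rewrite /= !add0r.
rewrite (expgS st 3) e3 mul_ext -(expgS jS 3) jS4 /inker.
by congr pair; rewrite /eval_s4 /=; zmod.
Qed.

Let conjX3 (e : E) : e ^ (ut ^+ 3) = ((e ^ ut) ^ ut) ^ ut.
Proof. by rewrite !expgS expg0 mulg1 !conjgM. Qed.
Let conjX2 (e : E) : e ^ (st ^+ 2) = (e ^ st) ^ st.
Proof. by rewrite expg2 conjgM. Qed.
(** The elements [st ^+ 2] and [ut ^+ 3] differ by a central factor, hence conjugate alike. *)
Let conj_s2u3 (e : E) : (e ^ st) ^ st = ((e ^ ut) ^ ut) ^ ut.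
Proof. by rewrite -conjX2 -conjX3 s2u3 conjgM; congr (_ ^ _); rewrite conjgE cen mulKg. Qed.

Let xVy : (xt^-1) ^ y = i (- eval_c f)%R * xt^-1.
Proof. by rewrite conjVg conjgE xy (mulgA y^-1) cen -mulgA mulKg ceV. Qed.

(** Write [y^s = mu x^-1] and [y^u = la x^-1 y] with [mu] and [la] central, and c, d for the values
    of [f]. Comparing conjugation by [s^2] and [u^3] on [x] gives [mu = 2 la - c], on [y] it gives
    [mu = 2 la + 2 d - c]. *)
Lemma eval_d_torsion : (eval_d f *+ 2 = 0)%R.
Proof.
have [mu ys] := ysE; have [la yu] := yuE.
have h : xt^-1 * y = (y^-1 * xt)^-1 by rewrite invgM invgK.
have Ex : i mu * xt^-1 = i (la *+ 2 - eval_c f)%R * xt^-1.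
  rewrite -ys -xs conj_s2u3 xu ceJ yu cD ceJ conjMg conjVg xu ceV yu ceM cD.
  rewrite -conjgE xVy cD; congr (i _ * _); zmod.
have Ey : i mu * y^-1 = i (la *+ 2 + eval_d f *+ 2 - eval_c f)%R * y^-1.
  have -> : i mu * y^-1 = (y ^ st) ^ st by rewrite ys ceJ conjVg xs.
  rewrite conj_s2u3 yu ceJ (conjMg xt^-1) conjVg xu ceV yu ceM cD.
  rewrite -conjgE xVy cD ceJ conjVg xu ceV cD; congr (i _ * _); zmod.
have := ceI Ey; rewrite (ceI Ex) => e.
by apply: (zmod_from (esym e)); zmod.
Qed.

Hypotheses (fc : eval_c f = 0%R) (fd : eval_d f = 0%R).

Theorem trivial_split (sg up : A) :
  (sg *+ 2 - up *+ 3 = - eval_s2u3 f)%R -> (sg *+ 4 = - eval_s4 f)%R ->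
  exists v : GJ -> A, [/\ forall g h, v (g * h) = (v g + v h + f g h)%R,
    v jS = sg & v jU = up].
Proof.
move=> h2 h4.
have [la yu] := yuE; have [mu ys] := ysE.
(* Dividing both [x] and [y] by [la] repairs [y^u = x^-1 y]: the left side changes by one factor,
   the right side not at all. *)
pose x' := i (- la)%R * xt; pose y' := i (- la)%R * y.
have xs' : x' ^ st = y' by rewrite /x' ceJ xs.
have xu' : x' ^ ut = y' by rewrite /x' ceJ xu fd oppr0 inker0 mul1g.
have yu' : y' ^ ut = x'^-1 * y'.
  rewrite /y' ceJ yu cD /x' ceV ceM; congr (i _ * _); zmod.
have xy' : x' * y' = y' * x' by rewrite /x' /y' !ceM xy fc inker0 mul1g.
(* No freedom is left for this relation; it follows by computing the conjugate of [x'] by [s^2] as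
   that by [u^3]. *)
have ys' : y' ^ st = x'^-1.
  rewrite -xs' conj_s2u3 xu' yu' conjMg conjVg xu' yu'.
  by rewrite mulgA -invgM xy' invgM mulgVK.
pose s' := i sg * st; pose u' := i up * ut.
have cJ e m (e' : E) : e ^ (i m * e') = e ^ e'.
  by rewrite conjgM (conjgE e (i m)) cen mulKg.
have step (a b e : E) : a ^ e = b -> a * e = e * b by move=> <-; rewrite -conjgC.
have ov (m : A) (e : E) : overg (i m * e) = overg e.
  by rewrite overgM overg_inker mul1g.
have [|||||||||| v [vM vS vU _]] := @extension_split _ triv2 s' u' x' y'; rewrite ?ov //.
- by rewrite ceX h4 s4 -inkerD addNr inker0.
- rewrite !ceX s2u3 cD; congr (i _ * _).
  by apply: (zmod_from h2); zmod.
- by apply: step; rewrite cJ.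
- by apply: step; rewrite cJ.
- by apply: step; rewrite cJ.
- by apply: step; rewrite cJ.
by exists v; split; rewrite // ?vS ?vU /s' /u' inkerM addr0.
Qed.
End TrivialCoefficients.

Section Homomorphisms.
Variables (A : zmodType) (psi : GJ -> A).
Hypothesis psiM : forall g h, psi (g * h)%g = psi g + psi h.

Lemma hom1 : psi 1%g = 0.
Proof. by apply: (addrI (psi 1%g)); rewrite -psiM mulg1 addr0. Qed.

Lemma homV g : psi (g^-1)%g = - psi g.
Proof. by apply/eqP; rewrite -addr_eq0 -psiM mulVg hom1. Qed.

Lemma hom_expg g n : psi (g ^+ n)%g = psi g *+ n.
Proof. by elim: n => [|n IH]; rewrite ?expg0 ?hom1 // expgS psiM IH mulrS. Qed.

Lemma hom_relations : [/\ psi jS *+ 4 = 0, psi jS *+ 2 = psi jU *+ 3 & psi jX = 0].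
Proof.
split; rewrite -?hom_expg ?jS4 ?hom1 ?jS2U3 //.
have := congr1 psi jYU; rewrite !psiM homV => h.
by apply: (zmod_from h); zmod.
Qed.
End Homomorphisms.

Lemma hom_eq (A : zmodType) (psi chi : GJ -> A) :
  (forall g h, psi (g * h)%g = psi g + psi h) ->
  (forall g h, chi (g * h)%g = chi g + chi h) ->
  psi jS = chi jS -> psi jU = chi jU -> psi =1 chi.
Proof.
move=> psiM chiM eS eU; apply: jacobi_ind => //.
  by move=> g h eg eh; rewrite psiM chiM eg eh.
by have [_ _ ->] := hom_relations psiM; have [_ _ ->] := hom_relations chiM.
Qed.

(** A homomorphism to an abelian group is a splitting of the zero cocycle; the values 3 and 2
    satisfy [2 * 3 = 3 * 2] and [4 * 3 = 0] in Z/12. *)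
Lemma exists_chi : exists chi : GJ -> 'Z_12,
  [/\ forall g h, chi (g * h)%g = chi g + chi h, chi jS = 3%:R & chi jU = 2%:R].
Proof.
have fP : @trivial_cocycle 'Z_12 (fun _ _ => 0) by [].
have [||||v [vM vS vU]] := @trivial_split _ _ fP _ _ 3%:R 2%:R.
- by rewrite /eval_c subrr.
- by rewrite /eval_d !subrr.
- by rewrite /eval_s2u3 !subrr oppr0; apply/eqP.
- by rewrite /eval_s4 !addr0 oppr0; apply/eqP.
by exists v; split=> // g h; rewrite vM addr0.
Qed.

(* [psi jS - psi jU] is the value of [psi] on a generator of Z/12, since
   3 - 2 = 1. *)
Lemma hom_chi (chi : GJ -> 'Z_12) (A : zmodType) (psi : GJ -> A) :
  (forall g h, chi (g * h)%g = chi g + chi h) -> chi jS = 3%:R -> chi jU = 2%:R ->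
  (forall g h, psi (g * h)%g = psi g + psi h) ->
  let t := psi jS - psi jU in t *+ 12 = 0 /\ forall g, psi g = t *+ (chi g : nat).
Proof.
move=> chiM chiS chiU psiM t; have [s4 s2u3 _] := hom_relations psiM.
have t12 : t *+ 12 = 0.
  have s3 : t *+ 3 = psi jS by apply: (zmod_from s2u3); rewrite /t; zmod.
  by rewrite (mulrnA t 3 4) s3.
split=> //; apply: hom_eq => // [g h||].
- by rewrite chiM /= -mulrnDr; apply/esym; rewrite [in LHS](divn_eq (chi g + chi h) 12)
    [in LHS]mulrnDr mulnC mulrnA t12 mul0rn add0r.
- by rewrite chiS; apply: (zmod_from (esym s2u3)); rewrite /t /=; zmod.
- by rewrite chiU; apply: (zmod_from (esym s2u3)); rewrite /t /=; zmod.
Qed.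

(** * Explicit cocycles *)

Definition mod2_vec := ('Z_2 * 'Z_2)%type.

Definition mod2_act (g : GJ) (m : mod2_vec) : mod2_vec :=
  ((ja g)%:~R * m.1 + (jb g)%:~R * m.2, (jc g)%:~R * m.1 + (jd g)%:~R * m.2).

Lemma mod2_actD g : {morph mod2_act g : m n / m + n}.
Proof. by move=> m n; rewrite /mod2_act; congr pair; rewrite /= !mulrDr addrACA. Qed.
Lemma mod2_act1 m : mod2_act 1%g m = m.
Proof.
by case: m => p q; rewrite /mod2_act !jcoord /= !mul1r !mul0r addr0 add0r.
Qed.
Lemma mod2_actM g h m : mod2_act (g * h)%g m = mod2_act g (mod2_act h m).
Proof. by rewrite /mod2_act !jcoord /= !rmorphD !rmorphM; congr pair; ring. Qed.
Lemma mod2_act0 g : mod2_act g 0 + 0 = 0 + 0.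
Proof. by rewrite !addr0; apply: (addrI (mod2_act g 0)); rewrite -mod2_actD !addr0. Qed.

Definition mod2_split : cocycle2 mod2_vec :=
  @Cocycle2 _ mod2_act (fun _ _ => 0) mod2_actD mod2_act1 mod2_actM
    (fun g _ _ => mod2_act0 g).

(* This derivation is not principal; its cup product with the translation part
   of the group detects the summand Z/2 of H_2. *)
Lemma exists_derivation : exists D : GJ -> mod2_vec,
  [/\ forall g h, D (g * h)%g = D g + mod2_act g (D h),
      D jS = (1, 1), D jU = 0 & D jX = 0].
Proof.
(* A derivation is a section of the split extension, so it suffices that these lifts of the
   generators satisfy the relations. *)
pose E := extension mod2_split.
pose s : E := ((1, 1), jS); pose u : E := (0, jU).
pose x : E := (0, jX); pose y : E := (0, jY).
have [||||||||||v [vM vS vU vX]] := @extension_split _ mod2_split s u x y; try by [].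
- have s2 : (s ^+ 2)%g = (0, (jS ^+ 2)%g).
    by rewrite !expg2 mul_ext /= /mod2_act !jcoord; congr pair; apply/eqP.
  rewrite (expgnA s 2 2) s2 expg2 mul_ext -expgnDr jS4; congr pair.
  by rewrite /= /mod2_act /= !mulr0 !addr0; apply/eqP.
- rewrite expg2 /s mul_ext (expgS u 2) (expg2 u) /u !mul_ext -!(expg2 jS).
  rewrite jS2U3 (expgS jU 2) (expg2 jU) /=; congr pair.
  by rewrite /mod2_act /= !jcoord; apply/eqP.
- by rewrite /x /y !mul_ext jXY /= /mod2_act /= !mulr0.
- rewrite /x /y /s !mul_ext jXS; congr pair.
  by rewrite /= /mod2_act /= !jcoord; apply/eqP.
- have -> : (x^-1)%g = (0, (jX^-1)%g) :> E.
    apply/mulg1_eq; rewrite mul_ext mulgV; congr pair.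
    by rewrite /= /mod2_act /= !jcoord; apply/eqP.
  rewrite /y /s !mul_ext jYS; congr pair.
  by rewrite /= /mod2_act /= !jcoord; apply/eqP.
- by rewrite /x /y /u !mul_ext jXU /= /mod2_act /= !mulr0.
- have -> : (x^-1)%g = (0, (jX^-1)%g) :> E.
    apply/mulg1_eq; rewrite mul_ext mulgV; congr pair.
    by rewrite /= /mod2_act /= !jcoord; apply/eqP.
  by rewrite /y /u !mul_ext jYU; congr pair; rewrite /= /mod2_act /= ?(mulr0, addr0); apply/eqP.
by exists v; split=> // g h; rewrite vM addr0.
Qed.

Section CupProduct.
Variable D : GJ -> mod2_vec.
Hypothesis DM : forall g h, D (g * h)%g = D g + mod2_act g (D h).
Hypotheses (DS : D jS = (1, 1)) (DU : D jU = 0) (DX : D jX = 0).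

Definition cup (g h : GJ) : 'Z_2 := (jv g)%:~R * (D h).1 + (jw g)%:~R * (D h).2.

Lemma D_translY : D jY = 0.
Proof.
have := congr1 D jXS; rewrite !DM DX DS add0r /mod2_act !jcoord /=.
case: (D jY) => p q /eqP h; apply/eqP; move: h.
by case: p => [[|[|//]] ?]; case: q => [[|[|//]] ?].
Qed.

(** Translations are rows with [v(gh) = v(g) h + v(h)], values of [D] are columns with
    [D(gh) = D(g) + g D(h)]; in the product of row and column the mixed terms [v(g) h D(k)]
    cancel. *)
Lemma cup_cocycle : trivial_cocycle cup.
Proof. by move=> g h k; rewrite /cup DM /mod2_act !jcoord /= !rmorphD !rmorphM; ring. Qed.

Lemma eval_d_cup : eval_d cup = 1.
Proof. by rewrite /eval_d /cup D_translY DS DU !jcoord; apply/eqP. Qed.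

Lemma eval_c_cup : eval_c cup = 0.
Proof. by rewrite /eval_c /cup D_translY DX !jcoord; apply/eqP. Qed.
End CupProduct.

Definition quad (v w : int) : int := v * v + v * w + w * w.

(** Modulo 2 the form is 0 at the zero vector and 1 elsewhere, so every invertible matrix preserves
    it; the cases over F_2 are enumerated. *)
Lemma quad_even (g : GJ) (v w : int) :
  exists k : int, quad v w - quad (v * ja g + w * jc g) (v * jb g + w * jd g) = k * 2.
Proof.
apply/dvdzP; rewrite /quad.
have h2 (z : int) : (z%:~R == 0 :> 'F_2) = (2 %| z)%Z.
  by rewrite (dvdz_pcharf (pchar_Fp _)).
rewrite -h2; have /(congr1 (fun z : int => z%:~R : 'F_2)) := det_jacobi g.
rewrite !(rmorphB, rmorphD, rmorphM, rmorph1) /=.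
move: ((ja g)%:~R) ((jb g)%:~R) ((jc g)%:~R) ((jd g)%:~R) (v%:~R) (w%:~R).
move=> a b c d p q.
by case: a => [[|[|//]] ?]; case: b => [[|[|//]] ?]; case: c => [[|[|//]] ?];
  case: d => [[|[|//]] ?]; case: p => [[|[|//]] ?]; case: q => [[|[|//]] ?].
Qed.

(* The cocycle of the integral Heisenberg group, twice which is the right-hand
   side of [heisE]; integrality holds because [quad] is the quadratic form mod 2
   of Arf invariant 1, the one fixed by SL_2(Z). *)
Definition heis (g h : GJ) : int :=
  ((quad (jv g) (jw g) - quad (jv g * ja h + jw g * jc h) (jv g * jb h + jw g * jd h))
    %/ 2)%Z
  - ((jv g * ja h + jw g * jc h) * jv h + (jv g * jb h + jw g * jd h) * jv h
     + (jv g * jb h + jw g * jd h) * jw h).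

Lemma heisE (g h : GJ) : heis g h * 2 =
  quad (jv g) (jw g) - quad (jv g * ja h + jw g * jc h) (jv g * jb h + jw g * jd h)
  - 2 * ((jv g * ja h + jw g * jc h) * jv h + (jv g * jb h + jw g * jd h) * jv h
     + (jv g * jb h + jw g * jd h) * jw h).
Proof.
by rewrite /heis; have [k ->] := quad_even h (jv g) (jw g); rewrite mulzK //; ring.
Qed.

(** After doubling, the defect is, up to sign, [1 - det k] times the determinant formed by the
    vectors [v(g) h] and [v(h)]. *)
Lemma heis_cocycle : trivial_cocycle heis.
Proof.
move=> g h k; have two_neq0 : 2 != 0 :> int by [].
apply: (mulIf two_neq0); rewrite [LHS]mulrDl [RHS]mulrDl !heisE /quad !jcoord.
apply: subr0_eq.
transitivity ((1 - (ja k * jd k - jb k * jc k)) *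
  ((jv g * jb h + jw g * jd h) * jv h - (jv g * ja h + jw g * jc h) * jw h)).
  by ring.
by rewrite det_jacobi subrr mul0r.
Qed.

Lemma eval_c_heis : eval_c heis = 1.
Proof. by rewrite /eval_c /heis !jcoord. Qed.
Lemma eval_d_heis : eval_d heis = 0.
Proof. by have := eval_d_torsion heis_cocycle; lia. Qed.
Lemma heis1g g : heis 1%g g = 0.
Proof. by rewrite /heis !jcoord /quad !(mul0r, addr0). Qed.

(** * Homology *)

Section Quotient.
Variables (V : zmodType) (K : V -> Prop).
Hypotheses (K0 : K 0) (KB : forall x y, K x -> K y -> K (x - y)).

Let I : {pred V} := fun x => `[< K x >].
Let I_closed : zmod_closed I.
Proof.
split; first exact/asboolP.
by move=> x y /asboolP Kx /asboolP Ky; apply/asboolP/KB.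
Qed.
HB.instance Definition _ := GRing.isZmodClosed.Build V I I_closed.

(** Turns membership in a subgroup into vanishing in an abelian group, where the splitting results
    apply. *)
Lemma quotient_exists : exists (A : zmodType) (p : {additive V -> A}),
  (forall x, p x = 0 <-> K x) /\ (forall a, exists x, p x = a).
Proof.
exists (Quotient.quot I), \pi_(Quotient.quot I)%qT.
split=> [x|a]; last by exists (repr a); exact: (@reprK _ (Quotient.quot I) a).
have -> : (\pi_(Quotient.quot I)%qT x = 0) <-> x - 0 \in I.
  rewrite Quotient.idealrBE; split => [h|/eqP h]; first by apply/eqP; rewrite h raddf0.
  by rewrite h raddf0.
by rewrite subr0; split => /asboolP.
Qed.
End Quotient.

Definition zpair (A : zmodType) (F : word -> A) (c : chain) : A :=
  fglift (F : word -> zmodule A) c.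

Lemma zpair_is_additive (A : zmodType) (F : word -> A) : zmod_morphism (zpair F).
Proof. exact: (@lift_is_additive int word (zmodule A)). Qed.

HB.instance Definition _ (A : zmodType) (F : word -> A) :=
  GRing.isZmodMorphism.Build chain A (zpair F) (zpair_is_additive F).

(* Fixes the choice structure on words, for which several convertible instances
   can be inferred. *)
Definition cell (s : word) : chain := << s >>.
Definition cell1 (g : GJ) : chain := cell [:: g].
Definition cell2 (g h : GJ) : chain := cell [:: g; h].

Lemma zpairU (A : zmodType) (F : word -> A) s : zpair F (cell s) = F s.
Proof. by rewrite /zpair /cell liftU scale1r. Qed.

Lemma chainU k (s : word) : << k *g s >> = cell s *~ k :> chain.
Proof. by rewrite /cell freegU_mulz intz. Qed.

Lemma additive_zpair (A : zmodType) (L : {additive chain -> A}) (c : chain) :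
  L c = zpair (fun s => L (cell s)) c.
Proof.
rewrite -[in LHS](freeg_sumE c) -[in RHS](freeg_sumE c) !raddf_sum.
by apply: eq_bigr => s _; rewrite chainU !raddfMz /= zpairU.
Qed.

Lemma zpair_comp (A B : zmodType) (h : {additive A -> B}) (F : word -> A) c :
  h (zpair F c) = zpair (fun s => h (F s)) c.
Proof.
rewrite -(freeg_sumE c) !raddf_sum; apply: eq_bigr => s _.
by rewrite chainU !raddfMz /= !zpairU.
Qed.

Lemma eq_zpair (A : zmodType) (F F' : word -> A) n c : chain_deg n c ->
  (forall s, size s = n -> F s = F' s) -> zpair F c = zpair F' c.
Proof.
move=> dc eF; rewrite -(freeg_sumE c) !raddf_sum !big_seq; apply: eq_bigr => s.
by rewrite mem_dom => /dc sz; rewrite chainU !raddfMz /= !zpairU eF.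
Qed.

Lemma zpair0 (A : zmodType) (F : word -> A) n c : chain_deg n c ->
  (forall s, size s = n -> F s = 0) -> zpair F c = 0.
Proof.
move=> dc eF; rewrite (eq_zpair (F' := fun=> 0) dc eF).
by rewrite -(freeg_sumE c) raddf_sum big1 // => s _; rewrite chainU raddfMz /= zpairU mul0rz.
Qed.

Lemma bd_is_additive : zmod_morphism bd.
Proof. exact: (@lift_is_additive int word chain). Qed.
HB.instance Definition _ := GRing.isZmodMorphism.Build chain chain bd bd_is_additive.

Lemma bdU s : bd (cell s) = bd_gen s.
Proof. by rewrite /bd /cell liftU scale1r. Qed.

Lemma zpair_bd (A : zmodType) (F : word -> A) c :
  zpair F (bd c) = zpair (fun s => zpair F (bd_gen s)) c.
Proof.
rewrite -(freeg_sumE c) !raddf_sum; apply: eq_bigr => s _.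
by rewrite chainU !raddfMz /= bdU zpairU.
Qed.

Lemma bd1 g : bd_gen [:: g] = 0.
Proof. by rewrite /bd_gen !big_ord_recl big_ord0 /face /= expr0 expr1 scale1r scaleN1r addr0 subrr. Qed.

Lemma bd2 g h : bd_gen [:: g; h] = cell1 h - cell1 (g * h)%g + cell1 g.
Proof.
rewrite /bd_gen !big_ord_recl big_ord0 /face /= expr0 expr1 sqrrN expr1n.
by rewrite !scale1r scaleN1r addr0 addrA.
Qed.

Lemma bd3 g h k : bd_gen [:: g; h; k] =
  cell2 h k - cell2 (g * h)%g k + cell2 g (h * k)%g - cell2 g h.
Proof.
rewrite /bd_gen !big_ord_recl big_ord0 /face /=.
rewrite /bump /= !exprS expr0 !(mulN1r, mulr1, opprK) !(scale1r, scaleN1r).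
by rewrite addr0 !addrA.
Qed.

Definition fun1 (A : Type) (F : GJ -> A) (s : word) : A := F (nth jone s 0).
Definition fun2 (A : Type) (F : GJ -> GJ -> A) (s : word) : A :=
  F (nth jone s 0) (nth jone s 1).

Lemma zpair_bd2 (A : zmodType) (F : GJ -> A) d : chain_deg 2 d ->
  zpair (fun1 F) (bd d) = zpair (fun2 (fun g h => F h - F (g * h)%g + F g)) d.
Proof.
move=> dd; rewrite zpair_bd; apply: (eq_zpair dd).
case=> [|g [|h [|]]] // _.
by rewrite bd2 raddfD raddfB /= !zpairU.
Qed.

Lemma zpair_bd3 (A : zmodType) (F : GJ -> GJ -> A) d : chain_deg 3 d ->
  trivial_cocycle F -> zpair (fun2 F) (bd d) = 0.
Proof.
move=> dd FP; rewrite zpair_bd; apply: (zpair0 dd).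
case=> [|g [|h [|k [|]]]] // _.
rewrite bd3 raddfB raddfD raddfB /= !zpairU /fun2 /=.
by apply: (zmod_from (FP g h k)); zmod.
Qed.

Lemma chain_degB n c d : chain_deg n c -> chain_deg n d -> chain_deg n (c - d).
Proof.
move=> dc dd s; rewrite coeffB => h.
have [/eqP c0|/dc//] := boolP (coeff s c == 0).
by apply: dd; apply: contraNN h => /eqP ->; rewrite c0 subrr.
Qed.

Lemma chain_deg0 n : chain_deg n 0.
Proof. by move=> s; rewrite coeff0 eqxx. Qed.

Lemma chain_degN n c : chain_deg n c -> chain_deg n (- c).
Proof. by rewrite -sub0r; apply: chain_degB; apply: chain_deg0. Qed.

Lemma chain_degD n c d : chain_deg n c -> chain_deg n d -> chain_deg n (c + d).
Proof. by move=> dc dd; rewrite -[d]opprK; apply/chain_degB/chain_degN. Qed.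

Lemma chain_degU n s : size s = n -> chain_deg n (cell s).
Proof.
move=> sz t; rewrite /cell coeffU mul1r; have [<-|] := eqVneq s t; first by [].
by rewrite eqxx.
Qed.

Lemma chain_degMn n c k : chain_deg n c -> chain_deg n (c *+ k).
Proof.
by move=> dc; elim: k => [|k IH]; [apply: chain_deg0 | rewrite mulrS; apply: chain_degD].
Qed.

Lemma chain_degMz n c k : chain_deg n c -> chain_deg n (c *~ k).
Proof.
by case: k => k dc; [|apply: chain_degN]; apply: chain_degMn.
Qed.

Lemma is_boundary0 n : is_boundary n 0.
Proof. by exists 0; split; [apply: chain_deg0 | rewrite raddf0]. Qed.

Lemma is_boundaryB n c d : is_boundary n c -> is_boundary n d -> is_boundary n (c - d).
Proof.
move=> [c' [dc ->]] [d' [dd ->]]; exists (c' - d'); split; first exact: chain_degB.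
by rewrite raddfB.
Qed.

Lemma is_boundaryMz n c k : is_boundary n c -> is_boundary n (c *~ k).
Proof.
by move=> [c' [dc ->]]; exists (c' *~ k); rewrite raddfMz; split=> //; apply: chain_degMz.
Qed.

Lemma is_boundaryD n c d : is_boundary n c -> is_boundary n d -> is_boundary n (c + d).
Proof.
by move=> bc bd'; rewrite -[d]opprK -[- d]sub0r; apply/is_boundaryB/is_boundaryB/bd'/is_boundary0.
Qed.

Theorem homology1 : homology_iso 1 'Z_12.
Proof.
have [chi [chiM chiS chiU]] := exists_chi.
exists (zpair (fun1 chi)); split; [|split].
- by move=> c d _ _; rewrite raddfB.
(* On [[S] - [U]] the value of [chi] is 3 - 2 = 1. *)
- move=> a; exists ((cell1 jS - cell1 jU) *+ a); split.
    split; first by apply/chain_degMn/chain_degB; apply: chain_degU.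
    by rewrite raddfMn raddfB /= !bdU !bd1 subrr mul0rn.
  rewrite raddfMn raddfB /= !zpairU /fun1 /= chiS chiU.
  have -> : 3%:R - 2%:R = 1 :> 'Z_12 by apply/eqP.
  by rewrite natr_Zp.
move=> c [dc _]; split; last first.
  move=> [d [dd ->]]; rewrite (zpair_bd2 _ dd); apply: (zpair0 dd).
  by move=> s _; rewrite /fun2 chiM; zmod.
move=> c0.
(* In chains modulo boundaries [g |-> [g]] is a homomorphism, hence factors through [chi] by
   [hom_chi]; so a cycle killed by [chi] is zero there. *)
have [A [p [pE _]]] := quotient_exists (@is_boundary0 1) (@is_boundaryB 1).
have psiM (g h : GJ) : p (cell1 (g * h)%g) = p (cell1 g) + p (cell1 h).
  have : p (cell1 h - cell1 (g * h)%g + cell1 g) = 0.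
    by apply/pE; exists (cell2 g h); rewrite bdU bd2; split=> //; apply: chain_degU.
  rewrite raddfD raddfB /= => e; apply: esym; apply: (zmod_from e); zmod.
have [t12 psiE] := hom_chi chiM chiS chiU psiM.
set t := _ - _ in t12 psiE.
have hadd : zmod_morphism (fun a : 'Z_12 => t *+ a).
  have hD (a b : 'Z_12) : t *+ (a + b)%R = t *+ a + t *+ b.
    rewrite -mulrnDr; apply/esym; rewrite [in LHS](divn_eq (a + b) 12).
    by rewrite [in LHS]mulrnDr mulnC mulrnA t12 mul0rn add0r.
  by move=> a b /=; rewrite -[in RHS](subrK b a) hD addrK.
pose h : {additive 'Z_12 -> A} :=
  HB.pack (fun a : 'Z_12 => t *+ a) (GRing.isZmodMorphism.Build _ _ _ hadd).
apply/pE; rewrite additive_zpair.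
rewrite (eq_zpair (F' := fun s => h (fun1 chi s)) dc); last first.
  by case=> [|g []] // _; rewrite /fun1 /= psiE.
by rewrite -zpair_comp c0 raddf0.
Qed.

Definition cycle_c : chain := cell2 jX jY - cell2 jY jX.
Definition cycle_d : chain :=
  cell2 jX jS - cell2 jS jY - (cell2 jX jU - cell2 jU jY).

Lemma bd_cell2 (g h : GJ) :
  bd (cell2 g h) = (cell1 h) - (cell1 (g * h)%g) + (cell1 g).
Proof. by rewrite bdU bd2. Qed.

Lemma deg_cell2 g h : chain_deg 2 (cell2 g h).
Proof. exact: chain_degU. Qed.

Lemma cycle_c_cycle : is_cycle 2 cycle_c.
Proof.
split; first by apply: chain_degB; apply: deg_cell2.
by rewrite /cycle_c raddfB /= !bd_cell2 jXY; zmod.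
Qed.

Lemma cycle_d_cycle : is_cycle 2 cycle_d.
Proof.
split; first by do 2!apply: chain_degB; apply: deg_cell2.
by rewrite /cycle_d !raddfB /= !bd_cell2 jXS jXU; zmod.
Qed.

Lemma zpair_cycle_c (A : zmodType) (F : GJ -> GJ -> A) :
  zpair (fun2 F) cycle_c = eval_c F.
Proof. by rewrite /cycle_c raddfB /= !zpairU. Qed.

Lemma zpair_cycle_d (A : zmodType) (F : GJ -> GJ -> A) :
  zpair (fun2 F) cycle_d = eval_d F.
Proof. by rewrite /cycle_d raddfB /= !raddfB /= !zpairU /eval_d /fun2 /=; zmod. Qed.

(** The cocycle identity at [(g, h, k)] is the vanishing of [p] on the boundary of [[g|h|k]]. *)
Lemma cell2_cocycle (A : zmodType) (p : {additive chain -> A}) :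
  (forall d, chain_deg 3 d -> p (bd d) = 0) ->
  trivial_cocycle (fun g h => p (cell2 g h)).
Proof.
move=> p0 g h k; have := p0 (cell [:: g; h; k]) (chain_degU (erefl _)).
rewrite bdU bd3 raddfB raddfD raddfB /= => e.
by apply: (zmod_from e); zmod.
Qed.

Lemma cycle_d_torsion : is_boundary 2 (cycle_d *+ 2).
Proof.
have [A [p [pE _]]] := quotient_exists (@is_boundary0 2) (@is_boundaryB 2).
have := eval_d_torsion (@cell2_cocycle _ p _).
rewrite /eval_d -!raddfB -raddfMn /= => h; apply/pE/h.
by move=> d dd; apply/pE; exists d.
Qed.

Lemma split_cocycle_cycle (A : zmodType) (F : GJ -> GJ -> A) (v : GJ -> A) z :
  (forall g h, v (g * h)%g = v g + v h + F g h) -> is_cycle 2 z ->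
  zpair (fun2 F) z = 0.
Proof.
move=> vM [dz bz].
have e1 : zpair (fun2 F) z = zpair (fun s => - fun2 (fun g h => v h - v (g * h)%g + v g) s) z.
  by apply: (eq_zpair dz) => s _; rewrite /fun2 vM; zmod.
have hN : zmod_morphism (fun a : A => - a) by move=> a b; rewrite opprD.
pose N : {additive A -> A} := HB.pack (fun a : A => - a) (GRing.isZmodMorphism.Build _ _ _ hN).
by rewrite e1 -(zpair_comp N) -(zpair_bd2 _ dz) bz !raddf0.
Qed.

Lemma pairMn (A B : zmodType) (a : A) (b : B) n :
  ((a, b) : A * B) *+ n = (a *+ n, b *+ n).
Proof. by elim: n => [|n IH]; rewrite ?mulr0n // !mulrS IH. Qed.

Lemma pairMz (A B : zmodType) (a : A) (b : B) (n : int) :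
  ((a, b) : A * B) *~ n = (a *~ n, b *~ n).
Proof. by case: n => n; rewrite /intmul pairMn. Qed.

Theorem homology2 : homology_iso 2 (int * 'Z_2)%type.
Proof.
have [D [DM DS DU DX]] := exists_derivation.
have cup_c := eval_c_cup DM DS DX; have cup_d := eval_d_cup DM DS DU DX.
have cupP := cup_cocycle DM.
(* The cocycles [heis] and [cup D] are dual to [cycle_c] and [cycle_d]. *)
pose phi z : (int * 'Z_2)%type := (zpair (fun2 heis) z, zpair (fun2 (cup D)) z).
have phiB : zmod_morphism phi by move=> x y; rewrite /phi !raddfB.
pose phiA : {additive chain -> (int * 'Z_2)%type} :=
  HB.pack phi (GRing.isZmodMorphism.Build _ _ phi phiB).
have phiD : {morph phi : x y / x + y} := raddfD phiA.
have phiMz n : {morph phi : x / x *~ n} := raddfMz phiA n.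
have phiMn n : {morph phi : x / x *+ n} := raddfMn phiA n.
have phi_c : phi cycle_c = (1, 0).
  by rewrite /phi !zpair_cycle_c eval_c_heis cup_c.
have phi_d : phi cycle_d = (0, 1).
  by rewrite /phi !zpair_cycle_d eval_d_heis cup_d.
have phi_bd z : is_boundary 2 z -> phi z = 0.
  move=> [d [dd ->]]; rewrite /phi (zpair_bd3 dd heis_cocycle).
  by rewrite (zpair_bd3 dd cupP).
exists phi; split; [|split].
- by move=> c d _ _; rewrite phiB.
- move=> [a b]; exists (cycle_c *~ a + cycle_d *+ b).
  have [[dc bc] [dd bd0]] := (cycle_c_cycle, cycle_d_cycle).
  split.
    split; first by apply/chain_degD/chain_degMn => //; apply: chain_degMz.
    by rewrite raddfD raddfMz raddfMn /= bc bd0 mul0rz mul0rn addr0.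
  rewrite phiD phiMz phiMn phi_c phi_d pairMz pairMn.
  by congr pair; rewrite /= ?mul0rn ?mul0rz ?addr0 ?add0r ?intz ?natr_Zp.
move=> z cz; split; last exact: phi_bd.
move=> phi0; have [dz bz] := cz.
pose al : chain := cell2 jS jS - cell2 jU (jU ^+ 2)%g - cell2 jU jU.
pose be : chain := cell2 jS (jS ^+ 3)%g + cell2 jS (jS ^+ 2)%g + cell2 jS jS + cell2 1%g 1%g.
(* Adjoining formal solutions of the two divisibility conditions of
   [trivial_split] to the chains modulo boundaries, [cycle_c] and [cycle_d]. *)
pose K (w : (chain * (int * int))%type) := exists b m n p q,
  [/\ is_boundary 2 b, w.1 = b + cycle_c *~ m + cycle_d *~ n + al *~ p + be *~ q,
      w.2.1 = - (p * 2 + q * 4) & w.2.2 = p * 3].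
have K0 : K 0.
  by exists 0, 0, 0, 0, 0; split; rewrite ?mulr0z ?addr0 //; apply: is_boundary0.
have KB w w' : K w -> K w' -> K (w - w').
  move=> [b [m [n [p [q [bb e1 e2 e3]]]]]] [b' [m' [n' [p' [q' [bb' e1' e2' e3']]]]]].
  exists (b - b'), (m - m'), (n - n'), (p - p'), (q - q'); split.
  - exact: is_boundaryB.
  - by rewrite /= e1 e1' !mulrzBr; zmod.
  - by rewrite /= e2 e2'; ring.
  - by rewrite /= e3 e3'; ring.
have [A [p [pE _]]] := quotient_exists K0 KB.
pose inl (c : chain) : (chain * (int * int))%type := (c, 0).
have inlB : zmod_morphism (fun c => p (inl c)).
  by move=> x y; rewrite -raddfB /inl; congr (p (_, _)).
pose L : {additive chain -> A} :=
  HB.pack (fun c => p (inl c)) (GRing.isZmodMorphism.Build _ _ _ inlB).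
have LE c : L c = p (inl c) by [].
pose F g h := L (cell2 g h).
have FP : trivial_cocycle F.
  apply: (@cell2_cocycle A L) => d dd; rewrite LE; apply/pE.
  exists (bd d), 0, 0, 0, 0; split=> //; last by rewrite !mulr0z !addr0.
  by exists d.
have Lzpair c : chain_deg 2 c -> L c = zpair (fun2 F) c.
  by move=> dc; rewrite additive_zpair; apply: (eq_zpair dc) => -[|g [|h []]].
have Fc : eval_c F = 0.
  rewrite -zpair_cycle_c -Lzpair; last by case: cycle_c_cycle.
  rewrite LE; apply/pE; exists 0, 1, 0, 0, 0; split=> //; first exact: is_boundary0.
  by rewrite !mulr0z !addr0 add0r.
have Fd : eval_d F = 0.
  rewrite -zpair_cycle_d -Lzpair; last by case: cycle_d_cycle.
  rewrite LE; apply/pE; exists 0, 0, 1, 0, 0; split=> //; first exact: is_boundary0.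
  by rewrite !mulr0z !addr0 add0r.
pose e1 : (chain * (int * int))%type := (0, (1, 0)).
pose e2 : (chain * (int * int))%type := (0, (0, 1)).
(* The negated formal coordinates solve the two equations, because [K] contains [(al, (-2, 3))] and
   [(be, (-4, 0))]. *)
pose sg : A := - p e1; pose up : A := - p e2.
have pK x y : K (x - y) -> p x = p y.
  by move=> h; apply: subr0_eq; rewrite -raddfB; apply/pE.
have h2 : sg *+ 2 - up *+ 3 = - eval_s2u3 F.
  have -> : eval_s2u3 F = p (inl al) by rewrite /eval_s2u3 /F -!raddfB.
  have -> : sg *+ 2 - up *+ 3 = - p (0, (2, - 3%:Z)).
    have -> : (0, (2, - 3%:Z)) = e1 *+ 2 - e2 *+ 3.
      by rewrite /e1 /e2 !pairMn; congr (_, (_, _)); rewrite /= !mul0rn subr0.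
    by rewrite (raddfB p) !(raddfMn p) /sg /up; zmod.
  congr (- _); apply: pK; exists 0, 0, 0, (-1), 0; split=> //.
    exact: is_boundary0.
  by rewrite /= !mulr0z !addr0 !add0r.
have h4 : sg *+ 4 = - eval_s4 F.
  have -> : eval_s4 F = p (inl be) by rewrite /eval_s4 /F -!raddfD.
  have -> : sg *+ 4 = - p (0, (4, 0)).
    have -> : (0, (4, 0)) = e1 *+ 4.
      by rewrite /e1 !pairMn; congr (_, (_, _)); rewrite /= mul0rn.
    by rewrite (raddfMn p) /sg; zmod.
  congr (- _); apply: pK; exists 0, 0, 0, 0, (-1); split=> //.
    exact: is_boundary0.
  by rewrite /= !mulr0z !addr0 !add0r.
have [v [vM _ _]] := trivial_split FP Fc Fd h2 h4.
have /pE : p (inl z) = 0 by rewrite -LE Lzpair // (split_cocycle_cycle vM).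
move=> [b [m [n [p' [q' [bb /= ez' hp hq]]]]]].
(* The vectors [(-2, 3)] and [(-4, 0)] are independent, so a chain in [K] with zero formal
   coordinates involves neither [al] nor [be]: adjoining solutions created no new relation. *)
have p'0 : p' = 0 by lia.
have q'0 : q' = 0 by lia.
move: ez'; rewrite p'0 q'0 !mulr0z !addr0 => ez.
have : phi z = (m, n%:~R).
  rewrite ez !phiD !phiMz phi_c phi_d phi_bd // !pairMz.
  by congr pair; rewrite /= ?mul0rz ?addr0 ?add0r ?intz.
rewrite phi0 => -[m0 n0].
(* The Z/2 component of [phi z] makes [n] even, and twice [cycle_d] bounds. *)
have [k nk] : exists k : int, n = 2 * k.
  have dn : (2 %| n)%Z by rewrite (dvdz_pcharf (pchar_Fp (isT : prime 2))) -n0.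
  by have /dvdzP[k ->] := dn; exists k; rewrite mulrC.
rewrite ez -m0 nk mulr0z addr0 mulrzA.
by apply: is_boundaryD => //; apply: is_boundaryMz; exact: cycle_d_torsion.
Qed.

(** * Cohomology in degrees 1 and 2 *)

Definition cofun1_of (f : cochain 1) (g : GJ) : int := f [tuple of [:: g]].
Definition cofun2_of (f : cochain 2) (g h : GJ) : int := f [tuple of [:: g; h]].
Definition cofun3_of (f : cochain 3) (g h k : GJ) : int := f [tuple of [:: g; h; k]].

Lemma evE n (f : cochain n) (s : seq GJ) (sz : size s == n) : ev f s = f (Tuple sz).
Proof. by rewrite /ev insubT. Qed.

Lemma ev1 (f : cochain 1) (s : seq GJ) g : s = [:: g] -> ev f s = cofun1_of f g.
Proof. by move=> ->; rewrite (evE f (erefl : size [:: g] == 1)); congr f; apply: val_inj. Qed.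
Lemma ev2 (f : cochain 2) (s : seq GJ) g h : s = [:: g; h] -> ev f s = cofun2_of f g h.
Proof.
by move=> ->; rewrite (evE f (erefl : size [:: g; h] == 2)); congr f; apply: val_inj.
Qed.
Lemma ev3 (f : cochain 3) (s : seq GJ) g h k : s = [:: g; h; k] -> ev f s = cofun3_of f g h k.
Proof.
by move=> ->; rewrite (evE f (erefl : size [:: g; h; k] == 3)); congr f; apply: val_inj.
Qed.

Lemma tuple1P (t : 1.-tuple GJ) : exists g, t = [tuple of [:: g]].
Proof. by case: t => [[|g []] // sz]; exists g; apply: val_inj. Qed.
Lemma tuple2P (t : 2.-tuple GJ) : exists g h, t = [tuple of [:: g; h]].
Proof. by case: t => [[|g [|h []]] // sz]; exists g, h; apply: val_inj. Qed.
Lemma tuple3P (t : 3.-tuple GJ) : exists g h k, t = [tuple of [:: g; h; k]].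
Proof. by case: t => [[|g [|h [|k []]]] // sz]; exists g, h, k; apply: val_inj. Qed.
Lemma tuple4P (t : 4.-tuple GJ) : exists g h k l, t = [tuple of [:: g; h; k; l]].
Proof. by case: t => [[|g [|h [|k [|l []]]]] // sz]; exists g, h, k, l; apply: val_inj. Qed.

Lemma cobd1 (f : cochain 1) (g h : GJ) : cobd f [tuple of [:: g; h]] =
  cofun1_of f h - cofun1_of f (g * h)%g + cofun1_of f g.
Proof.
rewrite /cobd !big_ord_recl big_ord0 /bump /=.
rewrite (ev1 f (_ : face [:: g; h] 0 = [:: h])) //.
rewrite (ev1 f (_ : face [:: g; h] 1 = [:: (g * h)%g])) //.
rewrite (ev1 f (_ : face [:: g; h] 2 = [:: g])) //.
ring.
Qed.

Lemma cobd2 (f : cochain 2) (g h k : GJ) : cobd f [tuple of [:: g; h; k]] =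
  cofun2_of f h k - cofun2_of f (g * h)%g k + cofun2_of f g (h * k)%g - cofun2_of f g h.
Proof.
rewrite /cobd !big_ord_recl big_ord0 /bump /=.
rewrite (ev2 f (_ : face [:: g; h; k] 0 = [:: h; k])) //.
rewrite (ev2 f (_ : face [:: g; h; k] 1 = [:: (g * h)%g; k])) //.
rewrite (ev2 f (_ : face [:: g; h; k] 2 = [:: g; (h * k)%g])) //.
rewrite (ev2 f (_ : face [:: g; h; k] 3 = [:: g; h])) //.
ring.
Qed.

Lemma cobd3 (f : cochain 3) (g h k l : GJ) : cobd f [tuple of [:: g; h; k; l]] =
  cofun3_of f h k l - cofun3_of f (g * h)%g k l + cofun3_of f g (h * k)%g l
  - cofun3_of f g h (k * l)%g + cofun3_of f g h k.
Proof.
rewrite /cobd !big_ord_recl big_ord0 /bump /=.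
rewrite (ev3 f (_ : face [:: g; h; k; l] 0 = [:: h; k; l])) //.
rewrite (ev3 f (_ : face [:: g; h; k; l] 1 = [:: (g * h)%g; k; l])) //.
rewrite (ev3 f (_ : face [:: g; h; k; l] 2 = [:: g; (h * k)%g; l])) //.
rewrite (ev3 f (_ : face [:: g; h; k; l] 3 = [:: g; h; (k * l)%g])) //.
rewrite (ev3 f (_ : face [:: g; h; k; l] 4 = [:: g; h; k])) //.
ring.
Qed.

Theorem cohomology1 : cohomology_trivial 1.
Proof.
move=> f fP; have fM g h : cofun1_of f (g * h)%g = cofun1_of f g + cofun1_of f h.
  by have := fP [tuple of [:: g; h]]; rewrite cobd1; lia.
have [chi [chiM chiS chiU]] := exists_chi.
have [t12 fE] := hom_chi chiM chiS chiU fM.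
have t0 : cofun1_of f jS - cofun1_of f jU = 0 by lia.
exists (fun=> 0) => t; have [g ->] := tuple1P t.
rewrite -/(cofun1_of f g) fE t0 mul0rn.
by rewrite /cobd !big_ord_recl big_ord0 /ev /=; case: insub; rewrite ?mulr0.
Qed.

Lemma is_cocycle2P (f : cochain 2) : is_cocycle f <-> trivial_cocycle (cofun2_of f).
Proof.
split=> [fP g h k|fP t].
  by have := fP [tuple of [:: g; h; k]]; rewrite cobd2; lia.
by have [g [h [k ->]]] := tuple3P t; rewrite cobd2; have := fP g h k; lia.
Qed.

Definition cochain1_of (v : GJ -> int) : cochain 1 := fun t => v (thead t).
Definition cochain2_of (F : GJ -> GJ -> int) : cochain 2 :=
  fun t => F (tnth t 0) (tnth t 1).

Lemma cochain1_ofK v : cofun1_of (cochain1_of v) = v.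
Proof. by []. Qed.
Lemma cochain2_ofK F : cofun2_of (cochain2_of F) = F.
Proof. by []. Qed.

Lemma is_coboundary2P (f : cochain 2) : is_coboundary f <->
  exists v, forall g h, cofun2_of f g h = v h - v (g * h)%g + v g.
Proof.
split=> [[v vE]|[v vE]].
  by exists (cofun1_of v) => g h; rewrite /cofun2_of vE cobd1.
exists (cochain1_of v) => t; have [g [h ->]] := tuple2P t.
by rewrite cobd1 cochain1_ofK -vE.
Qed.

(** Over the integers the two conditions of [trivial_split] are solvable exactly when 12 divides
    this number. Coboundaries change it by multiples of 12, so modulo 12 it is the component of the
    class in Z/12. *)
Definition eval_ext (A : zmodType) (F : GJ -> GJ -> A) : A := eval_s2u3 F *+ 4 + eval_s4 F.

Section EvalLinear.
Variable A : zmodType.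
Implicit Types F : GJ -> GJ -> A.

Lemma eval_cB F F' : eval_c (fun g h => F g h - F' g h) = eval_c F - eval_c F'.
Proof. by rewrite /eval_c; zmod. Qed.
Lemma eval_dB F F' : eval_d (fun g h => F g h - F' g h) = eval_d F - eval_d F'.
Proof. by rewrite /eval_d; zmod. Qed.
Lemma eval_extB F F' : eval_ext (fun g h => F g h - F' g h) = eval_ext F - eval_ext F'.
Proof. by rewrite /eval_ext /eval_s2u3 /eval_s4; zmod. Qed.

Lemma eval_cobd (v : GJ -> A) :
  let F g h := v h - v (g * h)%g + v g in
  [/\ eval_c F = 0, eval_d F = 0 & eval_ext F = (v jS - v jU) *+ 12].
Proof.
split; first by rewrite /eval_c jXY; zmod.
  by rewrite /eval_d jXS jXU; zmod.
rewrite /eval_ext /eval_s2u3 /eval_s4 -!expgS mulg1 jS4 -jS2U3.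
rewrite -!expg2; zmod.
Qed.
End EvalLinear.

Lemma trivial_cocycleB (A : zmodType) (F F' : GJ -> GJ -> A) :
  trivial_cocycle F -> trivial_cocycle F' -> trivial_cocycle (fun g h => F g h - F' g h).
Proof.
move=> FP FP' g h k; have e1 := FP g h k; have e2 := FP' g h k.
transitivity (F h k + F g (h * k)%g - (F' h k + F' g (h * k)%g)); first by zmod.
by rewrite e1 e2; zmod.
Qed.

Section Bockstein.
Variable chi : GJ -> 'Z_12.
Hypothesis chiM : forall g h, chi (g * h)%g = chi g + chi h.
Hypotheses (chiS : chi jS = 3%:R) (chiU : chi jU = 2%:R).

(** The carry in the addition of Z/12, pulled back along [chi]. *)
Definition bockstein (g h : GJ) : int := ((chi g + chi h)%N %/ 12)%N.

Lemma bocksteinE g h :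
  bockstein g h * 12 = (chi g)%:Z + (chi h)%:Z - (chi (g * h)%g)%:Z.
Proof.
have -> : (chi (g * h)%g : nat) = ((chi g + chi h)%N %% 12)%N by rewrite chiM.
by rewrite /bockstein; have := divn_eq (chi g + chi h) 12; lia.
Qed.

Lemma bockstein_cocycle : trivial_cocycle bockstein.
Proof.
move=> g h k; move: (bocksteinE g h) (bocksteinE h k).
move: (bocksteinE (g * h)%g k) (bocksteinE g (h * k)%g); rewrite -mulgA.
move: (bockstein _ _) (bockstein _ _) (bockstein _ _) (bockstein _ _).
move: (chi _)%:Z (chi _)%:Z (chi _)%:Z (chi _)%:Z (chi _)%:Z (chi _)%:Z.
lia.
Qed.

Lemma eval_c_bockstein : eval_c bockstein = 0.
Proof.
have := bocksteinE jX jY; have := bocksteinE jY jX.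
by rewrite jXY /eval_c; lia.
Qed.

Lemma eval_ext_bockstein : eval_ext bockstein = 1.
Proof.
have chiX g n : chi (g ^+ n)%g = chi g *+ n by rewrite hom_expg.
by rewrite /eval_ext /eval_s2u3 /eval_s4 /bockstein !chiX (hom1 chiM) chiS chiU.
Qed.
End Bockstein.

Lemma split_of_eval (F : GJ -> GJ -> int) : trivial_cocycle F ->
  eval_c F = 0 -> (eval_ext F)%:~R = 0 :> 'Z_12 ->
  exists v, forall g h, F g h = v h - v (g * h)%g + v g.
Proof.
move=> FP Fc Fext.
have Fd : eval_d F = 0 by have := eval_d_torsion FP; lia.
have [k hk] : exists k, eval_ext F = 12 * k.
  have : (eval_ext F %% 12)%Z%:~R = 0 :> 'Z_12.
    rewrite -Fext [in RHS](divz_eq (eval_ext F) 12) [RHS]intrD [X in _ = X + _]intrM.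
    by rewrite (_ : 12%:~R = 0 :> 'Z_12) ?mulr0 ?add0r //; apply/eqP.
  have := modz_ge0 (eval_ext F) (isT : 12 != 0 :> int).
  have := ltz_pmod (eval_ext F) (isT : 0 < 12 :> int).
  case e : (eval_ext F %% 12)%Z => [n|n] // n12 _; rewrite -pmulrn Zp_nat.
  move=> /(congr1 val) /=; rewrite modn_small // => n0.
  exists (eval_ext F %/ 12)%Z.
  by rewrite {1}(divz_eq (eval_ext F) 12) e n0; lia.
(* If [a = eval_s2u3 F] and [4 a + eval_s4 F = 12 k], then [a - 3 k] and [a - 2 k] solve both
   equations. *)
have [||v [vM _ _]] := trivial_split FP Fc Fd (sg := eval_s2u3 F - 3 * k)
    (up := eval_s2u3 F - 2 * k); rewrite /eval_ext in hk; try lia.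
by exists (fun g => - v g) => g h; rewrite vM; lia.
Qed.

Theorem cohomology2 : cohomology_iso 2 (int * 'Z_12)%type.
Proof.
have [chi [chiM chiS chiU]] := exists_chi.
exists (fun f => (eval_c (cofun2_of f), (eval_ext (cofun2_of f))%:~R)); split; [|split].
- by move=> f g _ _; rewrite eval_cB eval_extB rmorphB.
(* The cocycle [heis] may have a nonzero class in Z/12, so [a] times it is completed by [b - a e]
   copies of the Bockstein cocycle. *)
- move=> [a b]; pose e := eval_ext heis; pose n : int := (b : nat)%:Z - a * e.
  pose F g h : int := heis g h *~ a - bockstein chi g h *~ (- n).
  have zm (G : GJ -> GJ -> int) m : trivial_cocycle G -> trivial_cocycle (fun g h => G g h *~ m).
    by move=> GP g h k; rewrite -!mulrzDl GP.
  exists (cochain2_of F); split.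
    apply/is_cocycle2P; rewrite cochain2_ofK; apply: trivial_cocycleB; apply: zm.
      exact: heis_cocycle.
    exact: bockstein_cocycle.
  have ec (G : GJ -> GJ -> int) m : eval_c (fun g h => G g h *~ m) = eval_c G *~ m.
    by rewrite /eval_c mulrzBl.
  have ee (G : GJ -> GJ -> int) m : eval_ext (fun g h => G g h *~ m) = eval_ext G *~ m.
    by rewrite /eval_ext /eval_s2u3 /eval_s4 !mulrzz; ring.
  rewrite cochain2_ofK /F eval_cB eval_extB !ec !ee eval_c_heis.
  rewrite (eval_c_bockstein chiM) (eval_ext_bockstein chiM chiS chiU).
  congr pair; first by rewrite mul0rz subr0 intz.
  have -> : eval_ext heis *~ a - 1 *~ (- n) = (b : nat)%:Z.
    by rewrite intz /n -/e -mulrzr intz; ring.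
  by rewrite -pmulrn natr_Zp.
move=> f /is_cocycle2P fP; split.
  by case=> fc fe; apply/is_coboundary2P/split_of_eval.
move=> /is_coboundary2P[v vE].
have [c0 d0 e0] := eval_cobd v.
have -> : cofun2_of f = fun g h => v h - v (g * h)%g + v g by do 2!apply: funext => ?.
rewrite c0 e0; congr pair.
by rewrite -mulr_natr rmorphM /= (_ : 12%:~R = 0 :> 'Z_12) ?mulr0 //; apply/eqP.
Qed.

(** * Rational cohomology in degree 3 *)

Section Antidifference.
Variable p : int -> rat.

(** The sign for negative arguments makes the recurrence [isumS] hold across 0. *)
Definition isum (n : int) : rat :=
  match n with
  | Posz n => \sum_(i < n) p i
  | Negz n => - \sum_(i < n.+1) p (- (i.+1)%:Z)
  end.

Lemma isumS (n : int) : isum (n + 1) = isum n + p n.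
Proof.
case: n => [n|[|n]].
- by rewrite -PoszD addn1 /= big_ord_recr.
- by rewrite /= big_ord1 big_ord0 addrC subrr.
have -> : Negz n.+1 + 1 = Negz n by rewrite !NegzE; lia.
by rewrite /= (big_ord_recr n.+1) /= opprD addrNK.
Qed.
End Antidifference.

Lemma eq_isum p q n : (forall j, p j = q j) -> isum p n = isum q n.
Proof. by move=> e; case: n => n; rewrite /= (eq_bigr _ (fun i _ => e _)). Qed.

Definition setv (k : GJ) (n : int) : GJ :=
  @mkJ (ja k) (jb k) (jc k) (jd k) n (jw k) (det_jacobi k).
Definition setw (k : GJ) (n : int) : GJ :=
  @mkJ (ja k) (jb k) (jc k) (jd k) (jv k) n (det_jacobi k).

Definition sum_alongX (p : GJ -> rat) (k : GJ) : rat := isum (fun j => p (setv k j)) (jv k).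
Definition sum_alongY (p : GJ -> rat) (k : GJ) : rat := isum (fun j => p (setw k j)) (jw k).

Lemma sum_alongXE p k : sum_alongX p (k * jX)%g = sum_alongX p k + p k.
Proof.
rewrite /sum_alongX; have -> : jv (k * jX)%g = jv k + 1 by rewrite !jcoord; ring.
rewrite isumS; congr (_ + p _); last by apply: jacobi_ext; rewrite !jcoord; ring.
by apply: eq_isum => j; congr p; apply: jacobi_ext; rewrite !jcoord; ring.
Qed.

Lemma sum_alongYE p k : sum_alongY p (k * jY)%g = sum_alongY p k + p k.
Proof.
rewrite /sum_alongY; have -> : jw (k * jY)%g = jw k + 1 by rewrite !jcoord; ring.
rewrite isumS; congr (_ + p _); last by apply: jacobi_ext; rewrite !jcoord; ring.
by apply: eq_isum => j; congr p; apply: jacobi_ext; rewrite !jcoord; ring.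
Qed.

Lemma sum_alongYX p k : (forall k, p (k * jX)%g = p k) ->
  sum_alongY p (k * jX)%g = sum_alongY p k.
Proof.
move=> pX; rewrite /sum_alongY; have -> : jw (k * jX)%g = jw k by rewrite !jcoord; ring.
apply: eq_isum => j; rewrite -[RHS]pX; congr p.
by apply: jacobi_ext; rewrite !jcoord; ring.
Qed.

(* The first cohomology of Z^2 with coefficients in all functions vanishes. *)
Lemma lattice_potential (xi eta : GJ -> rat) :
  (forall k, xi k + eta (k * jX)%g = eta k + xi (k * jY)%g) ->
  exists m : GJ -> rat, forall k,
    xi k = m k - m (k * jX)%g /\ eta k = m k - m (k * jY)%g.
Proof.
move=> h; pose m1 := sum_alongX (fun k => - xi k).
have m1X k : m1 (k * jX)%g = m1 k - xi k by rewrite /m1 sum_alongXE.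
(* Once [xi] is integrated along X, the remaining part [eta'] of [eta] is X-invariant, so summing it
   along Y leaves the first equation intact. *)
pose eta' k := m1 k - m1 (k * jY)%g - eta k.
have eta'X k : eta' (k * jX)%g = eta' k.
  rewrite /eta' -(mulgA k) jXY (mulgA k) !m1X; have := h k; lra.
pose m2 := sum_alongY eta'; exists (fun k => m1 k + m2 k) => k.
rewrite /m2 sum_alongYE (sum_alongYX _ eta'X) m1X /eta'; split; lra.
Qed.

(** * The module of rational functions on the group modulo constants *)

Definition normalized : {pred GJ -> rat} := fun h => h 1%g == 0.

Lemma normalized_closed : zmod_closed normalized.
Proof.
split; first by rewrite unfold_in.
by move=> h h' /eqP h0 /eqP h0'; rewrite unfold_in /= !fctE h0 h0' subrr.
Qed.
HB.instance Definition _ :=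
  GRing.isZmodClosed.Build (GJ -> rat) normalized normalized_closed.

(* Functions modulo constants, represented by their members vanishing at 1. *)
Definition nfun := {h : GJ -> rat | normalized h}.
HB.instance Definition _ := SubChoice.on nfun.
HB.instance Definition _ := [SubChoice_isSubZmodule of nfun by <:].

Definition fv (m : nfun) : GJ -> rat := val m.

Lemma fv1 m : fv m 1%g = 0. Proof. exact/eqP/(valP m). Qed.
Lemma fvD m n k : fv (m + n) k = fv m k + fv n k.
Proof. by []. Qed.
Lemma fvN m k : fv (- m) k = - fv m k.
Proof. by []. Qed.
Lemma nfunP m n : (forall k, fv m k = fv n k) -> m = n.
Proof. by move=> e; apply/val_inj/funext. Qed.

Lemma mkn_proof (h : GJ -> rat) : normalized (fun k => h k - h 1%g).
Proof. by rewrite /normalized subrr. Qed.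
Definition mkn (h : GJ -> rat) : nfun := exist (fun h => normalized h) _ (mkn_proof h).
Lemma mknE h k : fv (mkn h) k = h k - h 1%g. Proof. by []. Qed.

Definition nact (g : GJ) (m : nfun) : nfun := mkn (fun k => fv m (k * g)%g).
Lemma nactE g m k : fv (nact g m) k = fv m (k * g)%g - fv m g.
Proof. by rewrite /nact mknE mul1g. Qed.

Lemma nactD g : {morph nact g : m n / m + n}.
Proof. by move=> m n; apply: nfunP => k; rewrite fvD !nactE !fvD; lra. Qed.
Lemma nact1 m : nact 1%g m = m.
Proof. by apply: nfunP => k; rewrite nactE mulg1 fv1 subr0. Qed.
Lemma nactM g h m : nact (g * h)%g m = nact g (nact h m).
Proof. by apply: nfunP => k; rewrite !nactE mulgA; lra. Qed.

Definition nscale (q : rat) (m : nfun) : nfun := mkn (fun k => q * fv m k).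
Lemma nscaleE q m k : fv (nscale q m) k = q * fv m k.
Proof. by rewrite mknE fv1 mulr0 subr0. Qed.
Lemma nactZ g q m : nact g (nscale q m) = nscale q (nact g m).
Proof. by apply: nfunP => k; rewrite !(nactE, nscaleE); ring. Qed.
Lemma fvMn m n k : fv (m *+ n) k = fv m k *+ n.
Proof. by elim: n => [|n IH]; rewrite ?mulr0n // !mulrS fvD IH. Qed.
Lemma nscaleMn n m : (0 < n)%N -> nscale n%:R^-1 m *+ n = m.
Proof.
move=> n0; apply: nfunP => k; rewrite fvMn nscaleE -[LHS]mulr_natl mulrA divff ?mul1r //.
by rewrite pnatr_eq0 -lt0n.
Qed.

(** Right multiplication by X acts freely with infinite orbits, so the difference equation is solved
    by summing along them. *)
Lemma nact_surj (m : nfun) : exists n, m = n - nact jX n.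
Proof.
exists (mkn (sum_alongX (fun k => - fv m k))); apply: nfunP => k.
rewrite fvD fvN nactE !mknE sum_alongXE.
have := sum_alongXE (fun k => - fv m k) 1%g; rewrite mul1g fv1 => ->; lra.
Qed.

(** Modulo constants, the compatibility of [xi] and [eta] holds only up to the constant
    [fv eta jX - fv xi jY]. This is the obstruction in H^2(Z^2; Q); when it vanishes,
    [lattice_potential] applies. *)
Lemma nact_potential (xi eta : nfun) :
  xi + nact jX eta = eta + nact jY xi -> fv eta jX = fv xi jY ->
  exists m, xi = m - nact jX m /\ eta = m - nact jY m.
Proof.
move=> h k0.
have [k|m mE] := @lattice_potential (fv xi) (fv eta).
  by have := congr1 (fun m => fv m k) h; rewrite !fvD !nactE k0; lra.
exists (mkn m); split; apply: nfunP => k; rewrite fvD fvN nactE !mknE.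
  by have [e _] := mE 1%g; have [e' _] := mE k; move: e e'; rewrite fv1 mul1g; lra.
by have [_ e] := mE 1%g; have [_ e'] := mE k; move: e e'; rewrite fv1 mul1g; lra.
Qed.

(** Corresponds to [t] times the Heisenberg class under dimension shifting. *)
Definition heis_deriv (t : rat) (g : GJ) : nfun := mkn (fun k => t * (heis k g)%:~R).
Lemma heis_derivE t g k : fv (heis_deriv t g) k = t * (heis k g)%:~R.
Proof. by rewrite mknE heis1g mulr0 subr0. Qed.
Lemma heis_derivM t g h : heis_deriv t (g * h)%g = heis_deriv t g + nact g (heis_deriv t h).
Proof.
apply: nfunP => k; rewrite fvD nactE !heis_derivE.
have /(congr1 (fun z : int => z%:~R : rat)) := heis_cocycle k g h.
by rewrite !rmorphD /= => e; rewrite -!mulrBr -mulrDr; congr (_ * _); lra.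
Qed.

(** * Relations of the triangle groups (2, 4, 4) and (2, 3, 6) *)

Section Turns.
Local Open Scope group_scope.
Variable E : groupType.
Implicit Types s u x y : E.

Lemma commuteVl x y : x^-1 * y = y * x^-1 -> x * y = y * x.
Proof. by move=> /commute_sym/commuteV/commute_sym; rewrite invgK. Qed.

Lemma involution_inverts w x : w * w = 1 -> x * w * (x * w) = 1 -> x ^ w = x^-1.
Proof.
move=> ww xwxw; have wV : w^-1 = w by apply/mulg1_eq.
by rewrite conjgE wV; apply/esym/mulg1_eq; rewrite !mulgA in xwxw *.
Qed.

(* With a = s and b = x s, the relations a^4 = b^4 = (ab)^2 = 1 of a triangle
   group. *)
Lemma quarter_turn s x : s ^+ 4 = 1 -> (x * s) ^+ 4 = 1 -> (s * (x * s)) ^+ 2 = 1 ->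
  (x ^ s) ^ s = x^-1 /\ x * x ^ s = x ^ s * x.
Proof.
move=> s4 xs4 sxs2; have [w sw] : exists w, s * s = w by exists (s * s).
have ww : w * w = 1 by rewrite -sw -s4 (expgnDr s 2 2).
have xw : x ^ w = x^-1.
  apply: involution_inverts ww _.
  apply: (conjg_inj s^-1); rewrite conj1g -sxs2 conjgE invgK expg2 -sw.
  by rewrite !mulgA mulgK.
have h1 : (x ^ s) ^ s = x^-1 by rewrite -conjgM sw.
split=> //; move exs : (x ^ s) h1 (conjgC x s) => y h1 xs.
have yw : y ^ w = y^-1 by rewrite -sw conjgM h1 conjVg exs.
have wx t : w * (x * t) = x^-1 * (w * t).
  by rewrite !mulgA (conjgC x^-1 w) conjVg xw invgK.
have wy t : w * (y * t) = y^-1 * (w * t).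
  by rewrite (mulgA w) (mulgA y^-1) (conjgC y^-1 w) conjVg yw invgK.
have wyV t : w * (y^-1 * t) = y * (w * t).
  by rewrite (mulgA w) (mulgA y) (conjgC y w) yw.
(* As [w] inverts [x] and [y], the fourth power of [x s] becomes the commutator [x y^-1 x^-1 y]. *)
have xs2 : (x * s) ^+ 2 = x * (y^-1 * w).
  rewrite expg2 -(mulgA x s) xs (mulgA s s) sw.
  by have := wy 1; rewrite !mulg1 => ->.
have := xs4; rewrite (expgnA _ 2 2) xs2 expg2 -!mulgA wx wyV ww mulg1 mulgA.
by move=> /mulg1_eq; rewrite invgM invgK => e; apply: commuteVl.
Qed.

(* With a = u^-1 and b = x u^-2, the relations a^6 = b^3 = (ab)^2 = 1 of a
   triangle group. *)
Lemma sixth_turn u x : u ^+ 6 = 1 -> (x * u ^- 2) ^+ 3 = 1 ->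
  (u^-1 * (x * u ^- 2)) ^+ 2 = 1 ->
  (x ^ u) ^ u = x^-1 * x ^ u /\ x * x ^ u = x ^ u * x.
Proof.
move=> u6 xu3 uxu2.
have [w uw] : exists w, u ^+ 3 = w by exists (u ^+ 3).
have [v vE] : exists v, u ^+ 2 = v by exists (u ^+ 2).
have uv : u * v = w by rewrite -uw -vE -expgS.
have vu : v * u = w by rewrite -uw -vE -expgSr.
have ww : w * w = 1 by rewrite -uw -u6 (expgnDr u 3 3).
have uu : u * u = v by [].
rewrite vE in xu3 uxu2.
have wV : w^-1 = w by apply/mulg1_eq.
have xw : x ^ w = x^-1.
  apply: involution_inverts ww _.
  apply: (conjg_inj u); rewrite conj1g -uxu2 conjgE expg2 -wV -uv.
  by rewrite !invgM !mulgA mulgVK.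
move exu : (x ^ u) (conjgC x u) => y xu.
have xv : x ^ v = y ^ u by rewrite -exu -conjgM uu.
have vv : v * v = w * u by rewrite -uv -mulgA vu -uv mulgA uu.
have xvv : (x ^ v) ^ v = y^-1 by rewrite -conjgM vv conjgM xw conjVg exu.
have Vx t r : v^-1 * (t * r) = t ^ v * (v^-1 * r) by rewrite conjgE !mulgA mulgK.
have v3 : v^-1 * (v^-1 * v^-1) = 1.
  by rewrite -!invgM vv -mulgA uv ww invg1.
(* Collecting the powers of [v = u^2] on the right turns [(x v^-1)^3 = 1] into a product of
   conjugates of [x]; it yields [y^u], and its conjugate by [u] yields commutation. *)
have xyz : x * (x ^ v * y^-1) = 1.
  by rewrite -xu3 !expgS expg0 mulg1 -!(mulgA x) !(Vx x) (Vx (x ^ v)) xvv v3 mulg1.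
have h1 : y ^ u = x^-1 * y.
  rewrite -xv; apply: (mulgI x); apply: (mulIg y^-1).
  by rewrite mulVKg mulgV -(mulgA x).
split=> //; apply: commuteVl.
have := congr1 (fun t => t ^ u) xyz; rewrite conj1g conjMg exu conjMg conjVg h1.
by rewrite -conjgM vu xw mulgA => /divg1_eq.
Qed.
End Turns.

(** * Lifting the presentation to an extension by functions modulo constants *)

Section LiftRelations.
Local Open Scope group_scope.
Variables (E : groupType) (overE : E -> GJ) (i : nfun -> E).
Hypothesis overM : forall a b, overE (a * b) = overE a * overE b.
Hypothesis over_i1 : forall m, overE (i m) = 1.
Hypothesis iadd : forall m n, i (m + n)%R = i m * i n.
Hypothesis iinj : injective i.
Hypothesis same_overE : forall e e', overE e = overE e' -> exists m, e = i m * e'.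
Hypothesis mul_i : forall e m, e * i m = i (nact (overE e) m) * e.
Hypothesis lift : forall g, exists e, overE e = g.
Hypothesis twist : forall t, exists th : E -> E, {morph th : a b / a * b} /\
  forall e, th e = i (heis_deriv t (overE e)) * e.

Let over1 : overE 1 = 1.
Proof. by apply: (mulgI (overE 1)); rewrite -overM !mulg1. Qed.
Let overV a : overE a^-1 = (overE a)^-1.
Proof. by apply: (mulgI (overE a)); rewrite -overM !mulgV over1. Qed.
Let overX a n : overE (a ^+ n) = overE a ^+ n.
Proof. by elim: n => [|n IH]; rewrite ?expg0 // !expgS overM IH. Qed.
Let overJ a b : overE (a ^ b) = overE a ^ overE b.
Proof. by rewrite !conjgE !overM overV. Qed.

Let i0 : i 0 = 1.
Proof. by apply: (mulgI (i 0)); rewrite -iadd addr0 mulg1. Qed.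
Let iN m : i (- m)%R = (i m)^-1.
Proof. by apply/esym/mulg1_eq; rewrite -iadd subrr i0. Qed.
Let iX m n : i m ^+ n = i (m *+ n)%R.
Proof. by elim: n => [|n IH]; rewrite ?i0 // expgS IH -iadd mulrS. Qed.

Let nact0 g : nact g 0 = 0%R.
Proof. by apply: (addrI (nact g 0)); rewrite -nactD !addr0. Qed.
Let nactN g m : nact g (- m)%R = (- nact g m)%R.
Proof. by apply: (addrI (nact g m)); rewrite -nactD !subrr nact0. Qed.
Let nactB g m n : nact g (m - n)%R = (nact g m - nact g n)%R.
Proof. by rewrite nactD nactN. Qed.
Let iI m n (e : E) : i m * e = i n * e -> m = n.
Proof. by move=> /mulIg/iinj. Qed.
Let over_i m (e : E) : overE (i m * e) = overE e.
Proof. by rewrite overM over_i1 mul1g. Qed.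
Let iD m n (e : E) : i m * (i n * e) = i (m + n)%R * e.
Proof. by rewrite mulgA iadd. Qed.
Let icong m n (e : E) : m = n -> i m * e = i n * e.
Proof. by move=> ->. Qed.
Let ei m n (e e' : E) : (i m * e) * (i n * e') = i (m + nact (overE e) n)%R * (e * e').
Proof. by rewrite -mulgA (mulgA e) mul_i -mulgA iD. Qed.
Let conj_i m (e : E) : e ^ i m = i (nact (overE e) m - m)%R * e.
Proof. by rewrite conjgE -iN mul_i iD addrC. Qed.

(** The [n]-th power of any lift is a kernel element fixed by [g]; as the kernel is divisible, the
    lift can be corrected by an [n]-th part of it. *)
Let torsion_lift (g : GJ) n : (0 < n)%N -> g ^+ n = 1 ->
  exists e : E, overE e = g /\ e ^+ n = 1.
Proof.
move=> n0 gn; have [e0 og] := lift g.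
have [m em] : exists m, e0 ^+ n = i m * 1.
  by apply: same_overE; rewrite overX og over1.
rewrite mulg1 in em.
have gm : nact g m = m.
  by apply: (@iI _ _ e0); rewrite -og -mul_i -em -expgS -expgSr.
pose a := nscale n%:R^-1 (- m)%R.
have ga : nact g a = a by rewrite nactZ nactN gm.
exists (i a * e0); split; first by rewrite over_i.
have ce : commute (i a) e0 by rewrite /commute mul_i og ga.
by rewrite (expgMn _ ce) iX em -iadd nscaleMn // addNr i0.
Qed.

Let half (m : nfun) := nscale 2%:R^-1 m.
Let halfD m : (half m + half m = m)%R.
Proof. by rewrite -mulr2n nscaleMn. Qed.

(** Conjugating [a] and [b] separately by kernel elements preserves their orders, while by the
    surjectivity assumption it multiplies [a b] by any prescribed kernel element. If
    [(a b)^2 = i r], then [r] is fixed by [a b], and the factor [- r / 2] kills it. *)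
Let adjust_pair (a b : E) p q :
  (forall n, exists m1 m2, n = (m1 - nact (overE a) m1
    + nact (overE a) (m2 - nact (overE b) m2))%R) ->
  a ^+ p = 1 -> b ^+ q = 1 -> overE (a * b) ^+ 2 = 1 ->
  exists a' b' : E, [/\ overE a' = overE a, overE b' = overE b,
    a' ^+ p = 1, b' ^+ q = 1 & (a' * b') ^+ 2 = 1].
Proof.
move=> surj ap bq ab2; pose g := overE (a * b).
have [r er] : exists r, (a * b) ^+ 2 = i r * 1.
  by apply: same_overE; rewrite overX ab2 over1.
rewrite mulg1 in er.
have gr : nact g r = r.
  by apply: (@iI _ _ (a * b)); rewrite -mul_i -er -expgS -expgSr.
have [m1 [m2 mE]] := surj (- half r)%R.
exists (a ^ i (- m1)%R), (b ^ i (- m2)%R).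
have ovJ m (e : E) : overE (e ^ i m) = overE e by rewrite conj_i over_i.
split; [exact: ovJ | exact: ovJ | by rewrite -conjXg ap conj1g
  | by rewrite -conjXg bq conj1g | ].
have -> : a ^ i (- m1)%R * b ^ i (- m2)%R = i (- half r)%R * (a * b).
  rewrite (conj_i _ a) (conj_i _ b) (ei _ _ a b) mE.
  apply: icong; rewrite !nactN !nactB !nactN.
  by move: (nact (overE a) m1) (nact (overE a) (nact (overE b) m2)) (nact (overE a) m2)
    => A B C; zmod.
rewrite expg2 ei -(expg2 (a * b)) er -iadd -/g nactN nactZ gr -/(half r).
have -> : (- half r - half r + r = 0)%R.
  by rewrite -{3}(halfD r); move: (half r) => A; zmod.
exact: i0.
Qed.

Let section_quarter : exists s x : E, [/\ overE s = jS, overE x = jX, s ^+ 4 = 1,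
  (x ^ s) ^ s = x^-1 & x * x ^ s = x ^ s * x].
Proof.
have g4 : (jX * jS) ^+ 4 = 1.
  have e2 : (jX * jS) ^+ 2 = @mkJ (-1) 0 0 (-1) (-1) 1 erefl.
    by rewrite expg2; apply: jacobi_ext; rewrite !jcoord.
  by rewrite (expgnA _ 2 2) e2 expg2; apply: jacobi_ext; rewrite !jcoord.
have g2 : (jS * (jX * jS)) ^+ 2 = 1.
  have e : jS * (jX * jS) = @mkJ (-1) 0 0 (-1) 0 1 erefl.
    by apply: jacobi_ext; rewrite !jcoord.
  by rewrite e expg2; apply: jacobi_ext; rewrite !jcoord.
have [a [oa a4]] := @torsion_lift jS 4 isT jS4.
have [b [ob b4]] := @torsion_lift (jX * jS) 4 isT g4.
have [n||||a' [b' [oa' ob' a4' b4' ab2]]] := @adjust_pair a b 4 4; rewrite ?overM ?oa ?ob //.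
  have [k ->] := nact_surj n.
  have [k' ->] : exists k', k = nact jS k'.
    by exists (nact jS^-1%g k); rewrite -nactM mulgV nact1.
  (* With this choice the expression telescopes to [k - X k], where [k = S k']. *)
  exists (- nact (jX * jS)%g k')%R, k'; rewrite nactN nactB -!nactM.
  by move: (nact jS k') (nact (jX * jS)%g k') (nact (jS * (jX * jS))%g k')
    => A B C; zmod.
exists a', (b' * a'^-1).
have [] := @quarter_turn _ a' (b' * a'^-1) a4' _ _; rewrite ?mulgVK //.
by move=> h1 h2; split; rewrite ?overM ?overV ?oa' ?ob' ?oa ?ob ?mulgK.
Qed.

Let section_sixth : exists u x : E, [/\ overE u = jU, overE x = jX, u ^+ 6 = 1,
  (x ^ u) ^ u = x^-1 * x ^ u & x * x ^ u = x ^ u * x].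
Proof.
have gE : jX * jU ^- 2 = @mkJ 0 (-1) 1 (-1) 0 (-1) erefl.
  have -> : jU ^- 2 = jU ^+ 4.
    by apply/mulg1_eq; rewrite -expgnDr (expgnA jU 3 2) -jS2U3 -expgnA jS4.
  by rewrite jU4E; apply: jacobi_ext; rewrite !jcoord.
have UV : jU^-1 = @mkJ 1 (-1) 1 0 0 0 erefl.
  by rewrite -jU5E; apply/mulg1_eq; rewrite -expgS (expgnA jU 3 2) -jS2U3 -expgnA jS4.
have g3 : (jX * jU ^- 2) ^+ 3 = 1.
  rewrite gE expgS expg2.
  have -> : @mkJ 0 (-1) 1 (-1) 0 (-1) erefl * @mkJ 0 (-1) 1 (-1) 0 (-1) erefl
      = @mkJ (-1) 1 (-1) 0 (-1) 0 erefl :> GJ.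
    by apply: jacobi_ext; rewrite !jcoord.
  by apply: jacobi_ext; rewrite !jcoord.
have g2 : (jU^-1 * (jX * jU ^- 2)) ^+ 2 = 1.
  have -> : jU^-1 * (jX * jU ^- 2) = @mkJ (-1) 0 0 (-1) 0 (-1) erefl.
    by rewrite gE UV; apply: jacobi_ext; rewrite !jcoord.
  by rewrite expg2; apply: jacobi_ext; rewrite !jcoord.
have g6 : jU^-1 ^+ 6 = 1.
  by rewrite expVgn (expgnA jU 3 2) -jS2U3 -expgnA jS4 invg1.
have [a [oa a6]] := @torsion_lift jU^-1 6 isT g6.
have [b [ob b3]] := @torsion_lift (jX * jU ^- 2) 3 isT g3.
have [n||||a' [b' [oa' ob' a6' b3' ab2]]] := @adjust_pair a b 6 3; rewrite ?overM ?oa ?ob //.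
  have [k ->] := nact_surj n.
  have [k' ->] : exists k', k = nact (jU ^- 2)%g k'.
    by exists (nact (jU ^+ 2)%g k); rewrite -nactM mulVg nact1.
  (* Again the terms telescope to [k - X k], now with [k = U^-2 k']. *)
  exists (- (nact jU^-1%g k' + nact (jX * jU ^- 2)%g k'))%R, k'.
  have uu : jU^-1 * jU^-1 = jU ^- 2 by rewrite expg2 invgM.
  rewrite nactN nactB nactD -!nactM uu.
  move: (nact (jU ^- 2)%g k') (nact (jX * jU ^- 2)%g k') (nact jU^-1%g k').
  by move: (nact (jU^-1 * (jX * jU ^- 2))%g k') => A B C D; zmod.
pose u := a'^-1; pose x := b' * u ^+ 2.
have xu : x * u ^- 2 = b' by rewrite /x mulgK.
have uV : u^-1 = a' by rewrite /u invgK.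
have [|||h1 h2] := @sixth_turn _ u x; rewrite ?uV ?xu //.
  by rewrite /u expVgn a6' invg1.
exists u, x; split=> //.
- by rewrite /u overV oa' oa invgK.
- by rewrite /x /u overM overX overV ob' oa' ob oa invgK mulgVK.
- by rewrite /u expVgn a6' invg1.
Qed.

Let conj_iV m (e : E) : e ^ (i m)^-1 = i (m - nact (overE e) m)%R * e.
Proof.
rewrite -iN conj_i nactN; apply: icong.
by move: (nact _ m) => A; zmod.
Qed.

Let fix_half g n : nact g n = n -> nact g (half n) = half n.
Proof. by move=> e; rewrite nactZ e. Qed.

(** The sections over the two triangle groups are first made to agree on translations, by a
    Heisenberg twist of one and a conjugation of the other; a further conjugation that fixes the
    translations then reconciles [s^2] with [u^3]. *)
Lemma lift_relations : exists s u x y : E,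
  [/\ overE s = jS, overE u = jU & overE x = jX] /\
  [/\ s ^+ 4 = 1, s ^+ 2 = u ^+ 3 & x * y = y * x] /\
  [/\ x ^ s = y, y ^ s = x^-1, x ^ u = y & y ^ u = x^-1 * y].
Proof.
have [s0 [xA0 [os0 oxA0 s04 yAs0 xyA0]]] := section_quarter.
have [u0 [xB0 [ou0 oxB0 u06 yBu0 xyB0]]] := section_sixth.
have oyA0 : overE (xA0 ^ s0) = jY by rewrite overJ oxA0 os0 conjgE jXS mulKg.
have oyB0 : overE (xB0 ^ u0) = jY by rewrite overJ oxB0 ou0 conjgE jXU mulKg.
have [xi0 xiE] : exists xi, xA0 = i xi * xB0 by apply: same_overE; rewrite oxA0.
have [eta0 etaE] : exists eta, xA0 ^ s0 = i eta * xB0 ^ u0.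
  by apply: same_overE; rewrite oyA0.
(* [t] measures the obstruction in H^2(Z^2; Q) to gluing; twisting the first
   splitting by [t] times the Heisenberg derivation cancels it. *)
pose t : rat := (fv xi0 jY - fv eta0 jX)%R.
have [th [thM thE]] := twist t.
have th1 : th 1 = 1 by apply: (mulgI (th 1)); rewrite -thM !mulg1.
have thV a : th a^-1 = (th a)^-1 by apply: (mulgI (th a)); rewrite -thM !mulgV th1.
have thX a n : th (a ^+ n) = th a ^+ n.
  by elim: n => [|n IH]; rewrite ?expg0 // !expgS thM IH.
have thJ a b : th (a ^ b) = th a ^ th b by rewrite !conjgE !thM thV.
have over_th e : overE (th e) = overE e by rewrite thE over_i.
pose s := th s0; pose x := th xA0; pose y := x ^ s.
have yE : y = th (xA0 ^ s0) by rewrite thJ.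
have s4 : s ^+ 4 = 1 by rewrite -thX s04.
have ys : y ^ s = x^-1 by rewrite yE -thJ yAs0 thV.
have xy : x * y = y * x by rewrite yE -!thM xyA0.
have os : overE s = jS by rewrite over_th.
have ox : overE x = jX by rewrite over_th.
have oy : overE y = jY by rewrite yE over_th.
pose xi := (heis_deriv t jX + xi0)%R; pose eta := (heis_deriv t jY + eta0)%R.
have xE : x = i xi * xB0 by rewrite /x thE oxA0 xiE iD.
have yE' : y = i eta * xB0 ^ u0 by rewrite yE thE oyA0 etaE iD.
have rel : (xi + nact jX eta = eta + nact jY xi)%R.
  apply: (@iI _ _ (xB0 * xB0 ^ u0)).
  rewrite -oxB0 -ei -xE -yE' xy xE yE' ei oyB0 -xyB0.
  by [].
have kappa : fv eta jX = fv xi jY.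
  rewrite /eta /xi !fvD !heis_derivE /t.
  have hxy : heis jX jY = 0%R by rewrite /heis /quad !jcoord.
  have hyx : heis jY jX = (-1)%R by rewrite /heis /quad !jcoord.
  by rewrite hxy hyx mulrN1z mulr0z; lra.
have [m [xim etam]] := nact_potential rel kappa.
have [u1 u1E] : exists u1, u1 = u0 ^ (i m)^-1 by exists (u0 ^ (i m)^-1).
have xm : xB0 ^ (i m)^-1 = x by rewrite conj_iV oxB0 -xim -xE.
have ym : (xB0 ^ u0) ^ (i m)^-1 = y by rewrite conj_iV oyB0 -etam -yE'.
have ou1 : overE u1 = jU by rewrite u1E conj_iV over_i.
have u16 : u1 ^+ 6 = 1 by rewrite u1E -conjXg u06 conj1g.
have xu1 : x ^ u1 = y by rewrite -[in LHS]xm u1E -conjJg.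
have yu1 : y ^ u1 = x^-1 * y.
  by rewrite -[in LHS]ym u1E -conjJg yBu0 conjMg conjVg xm ym.
have [n nE] : exists n, s ^+ 2 = i n * u1 ^+ 3.
  by apply: same_overE; rewrite !overX os ou1 jS2U3.
(* Both [s^2] and [u1^3] invert [x] and [y], so their quotient [n] is fixed by X and Y; since both
   square to 1, [U^3] sends [n] to [- n]. *)
have xss : x ^ (s ^+ 2) = x^-1 by rewrite expg2 conjgM.
have yss : y ^ (s ^+ 2) = y^-1 by rewrite expg2 conjgM ys conjVg.
have xuuu : x ^ (u1 ^+ 3) = x^-1.
  rewrite !expgS expg0 mulg1 !conjgM xu1 yu1 conjMg conjVg xu1 yu1.
  by rewrite mulgA -invgM xy invgM mulgVK.
have yuuu : y ^ (u1 ^+ 3) = y^-1 by rewrite -xu1 -conjgM -expgS expgSr conjgM xuuu conjVg xu1.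
have nfix e : e ^ (s ^+ 2) = e ^ (u1 ^+ 3) -> nact (overE e) n = n.
  rewrite nE conjgM => /conjg_inj; rewrite conj_i => h.
  by apply: subr0_eq; apply: (@iI _ _ e); rewrite i0 mul1g.
have nx : nact jX n = n by rewrite -ox; apply: nfix; rewrite xss.
have ny : nact jY n = n by rewrite -oy; apply: nfix; rewrite yss.
have nw : (n + nact (jU ^+ 3)%g n = 0)%R.
  apply: (@iI _ _ (u1 ^+ 3 * u1 ^+ 3)).
  rewrite -ou1 -overX -ei -nE -expgnDr s4 i0 mul1g -expgnDr u16 //.
(* Conjugation by [n / 2] fixes [x] and [y] and multiplies [u1^3] by [n / 2 - U^3 (n / 2) = n]. *)
pose u := u1 ^ (i (half n))^-1.
have fixc e : nact (overE e) n = n -> e ^ (i (half n))^-1 = e.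
  by move=> h; rewrite conj_iV (fix_half h) subrr i0 mul1g.
have xn : x ^ (i (half n))^-1 = x by apply: fixc; rewrite ox.
have yn : y ^ (i (half n))^-1 = y by apply: fixc; rewrite oy.
exists s, u, x, y; split; [|split].
- by split; rewrite // /u conj_iV over_i.
- split=> //; rewrite /u -conjXg conj_iV overX ou1 nE; apply: icong.
  have wn : nact (jU ^+ 3)%g n = (- n)%R by apply/eqP; rewrite -addr_eq0 addrC nw.
  by rewrite nactZ wn; apply: nfunP => k; rewrite fvD fvN !nscaleE fvN; lra.
- split=> //; first by rewrite -[in LHS]xn /u -conjJg xu1 yn.
  by rewrite -[in LHS]yn /u -conjJg yu1 conjMg conjVg xn yn.
Qed.
End LiftRelations.

Definition cocycle3 (A : zmodType) (f : GJ -> GJ -> GJ -> A) : Prop :=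
  forall g h k l, f h k l + f g (h * k)%g l + f g h k =
    f (g * h)%g k l + f g h (k * l)%g.

Section RationalThree.
Variable f : GJ -> GJ -> GJ -> rat.
Hypothesis fP : cocycle3 f.

Definition shifted (g h : GJ) : nfun := mkn (fun k => f k g h).

Lemma shifted_cocycle (g h k : GJ) :
  nact g (shifted h k) + shifted g (h * k)%g = shifted (g * h)%g k + shifted g h.
Proof.
apply: nfunP => l; rewrite !fvD nactE !mknE.
by have := fP l g h k; have := fP 1%g g h k; rewrite !mul1g; lra.
Qed.

Definition nfun_cocycle : cocycle2 nfun :=
  @Cocycle2 nfun nact shifted nactD nact1 nactM shifted_cocycle.

Lemma extension_twist t : exists th : extension nfun_cocycle -> extension nfun_cocycle,
  {morph th : a b / (a * b)%g} /\
  forall e, th e = (inker nfun_cocycle (heis_deriv t (overg e)) * e)%g.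
Proof.
exists (fun e => (heis_deriv t e.2 + e.1, e.2)); split; last first.
  by move=> e; rewrite inkerM.
move=> [m g] [n h]; rewrite !mul_ext /=; congr pair.
rewrite heis_derivM nactD.
by move: (nact g _) (nact g n) => A B; zmod.
Qed.

Lemma shifted_split : exists v : GJ -> nfun,
  forall g h, v (g * h)%g = v g + nact g (v h) + shifted g h.
Proof.
have lift (g : GJ) : exists e : extension nfun_cocycle, overg e = g by exists (0, g).
have [s [u [x [y [[os ou ox] [[s4 su xy] [xs ys xu yu]]]]]]] :=
  @lift_relations (extension nfun_cocycle) (@overg _ nfun_cocycle)
    (@inker _ nfun_cocycle) (@overgM _ _) (@overg_inker _ _) (@inkerD _ _)
    (@inker_inj _ _) (@same_over _ _) (@mul_inker _ nfun_cocycle) lift extension_twist.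
have step (a b e : extension nfun_cocycle) : (a ^ e = b)%g -> (a * e = e * b)%g.
  by move=> <-; rewrite -conjgC.
have [v [vM _ _ _]] := extension_split os ou ox s4 su xy (step _ _ _ xs)
  (step _ _ _ ys) (step _ _ _ xu) (step _ _ _ yu).
by exists v.
Qed.

Theorem rational_cohomology3 : exists b : GJ -> GJ -> rat,
  forall g h k, f g h k = b h k - b (g * h)%g k + b g (h * k)%g - b g h.
Proof.
have [v vM] := shifted_split.
(* Subtracting the coboundary of [fun g h => fv (v h) g] leaves the cocycle
   [f 1 g h], independent of [k], which is the coboundary of [f 1 1 h]. *)
exists (fun g h => fv (v h) g + f 1%g 1%g h) => k g h.
have := congr1 (fun m => fv m k) (vM g h); rewrite !fvD nactE mknE.
have := fP 1%g 1%g g h; rewrite !mul1g; lra.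
Qed.
End RationalThree.

(** * Integral cohomology in degree 3 *)

(** Modulo Z, [F] is a cocycle with values in Q/Z. Divisibility makes the conditions on [sg] and
    [up] solvable, so only [eval_c] and [eval_d] obstruct; the splitting is then lifted to Q
    pointwise. *)
Lemma qz_split (F : GJ -> GJ -> rat) :
  (forall g h k, F h k + F g (h * k)%g - F (g * h)%g k - F g h \is a Num.int) ->
  eval_c F \is a Num.int -> eval_d F \is a Num.int ->
  exists v : GJ -> rat, forall g h, F g h - (v h - v (g * h)%g + v g) \is a Num.int.
Proof.
move=> FP Fc Fd.
have K0 : (0 : rat) \is a Num.int by exact: rpred0.
have KB (x y : rat) : x \is a Num.int -> y \is a Num.int -> x - y \is a Num.int.
  exact: rpredB.
have [A [p [pE pS]]] := quotient_exists K0 KB.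
have pP : trivial_cocycle (fun g h => p (F g h)).
  move=> g h k; apply: subr0_eq; rewrite -!raddfD -raddfB; apply/pE.
  by rewrite opprD addrA.
have ec : eval_c (fun g h => p (F g h)) = 0 by rewrite /eval_c -raddfB; apply/pE.
have ed : eval_d (fun g h => p (F g h)) = 0 by rewrite /eval_d -!raddfB; apply/pE.
pose al := eval_s2u3 F; pose be := eval_s4 F.
pose sg : rat := - be / 4; pose up : rat := (al - be / 2) / 3.
have pD := raddfD p; have pB := raddfB p; have pN := raddfN p; have pMn := raddfMn p.
have [||v [vM _ _]] := trivial_split pP ec ed (sg := p sg) (up := p up).
- rewrite /eval_s2u3 -!pB -!pMn -pB -pN -/(eval_s2u3 F); congr (p _).
  by rewrite -/al /sg /up; lra.
- rewrite /eval_s4 -!pD -!pMn -pN -/(eval_s4 F); congr (p _).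
  by rewrite -/be /sg; lra.
have [w wE] := choice (fun g => pS (- v g)).
exists w => g h; apply/pE; rewrite pB pD pB !wE vM; zmod.
Qed.

(** This is [eval_d_torsion] with coefficients in Q/Z. *)
Lemma double_eval_d_int (F : GJ -> GJ -> rat) :
  (forall g h k, F h k + F g (h * k)%g - F (g * h)%g k - F g h \is a Num.int) ->
  2 * eval_d F \is a Num.int.
Proof.
move=> FP; have K0 : (0 : rat) \is a Num.int by exact: rpred0.
have KB (x y : rat) : x \is a Num.int -> y \is a Num.int -> x - y \is a Num.int.
  exact: rpredB.
have [A [p [pE _]]] := quotient_exists K0 KB.
have pP : trivial_cocycle (fun g h => p (F g h)).
  move=> g h k; apply: subr0_eq; rewrite -!raddfD -raddfB; apply/pE.
  by rewrite opprD addrA.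
have pB := raddfB p; apply/pE; rewrite mulr_natl (raddfMn p) /eval_d !pB.
exact: eval_d_torsion pP.
Qed.

Lemma is_cocycle3P (f : cochain 3) : is_cocycle f <-> cocycle3 (cofun3_of f).
Proof.
split=> [fP g h k l|fP t].
  by have := fP [tuple of [:: g; h; k; l]]; rewrite cobd3; lia.
by have [g [h [k [l ->]]]] := tuple4P t; rewrite cobd3; have := fP g h k l; lia.
Qed.

Definition primitive (f : cochain 3) (b : GJ -> GJ -> rat) : Prop :=
  (forall g h k, (cofun3_of f g h k)%:~R =
     b h k - b (g * h)%g k + b g (h * k)%g - b g h) /\ eval_c b = 0.

(** Subtracting a multiple of the cocycle [heis] leaves the coboundary unchanged; it removes the
    value at c because [eval_c heis = 1], and keeps the value at d because [eval_d heis = 0]. *)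
Lemma primitive_normalize (f : cochain 3) (b : GJ -> GJ -> rat) :
  (forall g h k, (cofun3_of f g h k)%:~R =
     b h k - b (g * h)%g k + b g (h * k)%g - b g h) ->
  primitive f (fun g h => b g h - eval_c b * (heis g h)%:~R) /\
  eval_d (fun g h => b g h - eval_c b * (heis g h)%:~R) = eval_d b.
Proof.
move=> bP; split; first split.
- move=> g h k /=; rewrite bP.
  have e : (heis h k)%:~R + (heis g (h * k)%g)%:~R =
      (heis (g * h)%g k)%:~R + (heis g h)%:~R :> rat by rewrite -!intrD heis_cocycle.
  apply: subr0_eq.
  transitivity (eval_c b * ((heis h k)%:~R + (heis g (h * k)%g)%:~R
    - ((heis (g * h)%g k)%:~R + (heis g h)%:~R))); first by ring.
  by rewrite e subrr mulr0.
- rewrite eval_cB (_ : eval_c (fun g h => eval_c b * (heis g h)%:~R) =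
     eval_c b * (eval_c heis)%:~R); first by rewrite eval_c_heis mulr1 subrr.
  by move: (eval_c b) heis => q H; rewrite /eval_c intrB mulrBr.
- rewrite eval_dB (_ : eval_d (fun g h => eval_c b * (heis g h)%:~R) =
     eval_c b * (eval_d heis)%:~R); first by rewrite eval_d_heis mulr0 subr0.
  by move: (eval_c b) heis => q H; rewrite /eval_d !intrB !mulrBr.
Qed.

Lemma primitive_exists (f : cochain 3) : is_cocycle f -> exists b, primitive f b.
Proof.
move=> /is_cocycle3P fP.
have [|b bP] := @rational_cohomology3 (fun g h k => (cofun3_of f g h k)%:~R).
  by move=> g h k l; have := fP g h k l; rewrite -!rmorphD /= => ->.
by have [h _] := primitive_normalize bP; exists (fun g h => b g h - eval_c b * (heis g h)%:~R).
Qed.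

(** Two primitives differ by a rational cocycle, which vanishes on d because 2d bounds. *)
Lemma primitive_eval_d f b b' : primitive f b -> primitive f b' -> eval_d b = eval_d b'.
Proof.
move=> [bP bc] [bP' bc'].
have dP : trivial_cocycle (fun g h => b g h - b' g h).
  by move=> g h k; have := bP g h k; rewrite bP'; lra.
by have := eval_d_torsion dP; rewrite eval_dB; lra.
Qed.

Lemma primitive_int f b : primitive f b -> 2 * eval_d b \is a Num.int.
Proof.
move=> [bP _]; apply: double_eval_d_int => g h k.
rewrite (_ : _ - b g h = (cofun3_of f g h k)%:~R) ?intr_int // bP; lra.
Qed.

Lemma is_coboundary3P (f : cochain 3) : is_coboundary f <->
  exists c : GJ -> GJ -> int, forall g h k,
    cofun3_of f g h k = c h k - c (g * h)%g k + c g (h * k)%g - c g h.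
Proof.
split=> [[c cE]|[c cE]].
  by exists (cofun2_of c) => g h k; rewrite /cofun3_of cE cobd2.
exists (cochain2_of c) => t; have [g [h [k ->]]] := tuple3P t.
by rewrite cobd2 cochain2_ofK -cE.
Qed.

Lemma even_mod2 (z : int) : z%:~R = 0 :> 'Z_2 <-> exists k : int, z = 2 * k.
Proof.
split=> [z0|[k ->]]; last first.
  by rewrite intrM (_ : 2%:~R = 0 :> 'Z_2) ?mul0r //; apply/eqP.
have : (2 %| z)%Z by rewrite (dvdz_pcharf (pchar_Fp (isT : prime 2))); apply/eqP.
by move=> /dvdzP[k ->]; exists k; rewrite mulrC.
Qed.

Definition cochain3_of (F : GJ -> GJ -> GJ -> int) : cochain 3 :=
  fun t => F (tnth t 0) (tnth t 1) (tnth t 2%:R).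

Theorem cohomology3 : cohomology_iso 3 'Z_2.
Proof.
pose P f z := exists b, primitive f b /\ z%:~R = 2 * eval_d b.
have Pex f : exists z, is_cocycle f -> P f z.
  have [fP|nf] := pselect (is_cocycle f); last by exists 0.
  have [b bP] := primitive_exists fP.
  by have /intrP[z zE] := primitive_int bP; exists z => _; exists b.
have [Z ZP] := choice Pex.
have ZE f b : is_cocycle f -> primitive f b -> (Z f)%:~R = 2 * eval_d b.
  by move=> fP bP; have [b' [b'P ->]] := ZP f fP; rewrite (primitive_eval_d bP b'P).
exists (fun f => (Z f)%:~R); split; [|split].
- move=> f g fP gP; rewrite -rmorphB; congr (_%:~R).
  have [b [bP bZ]] := ZP f fP; have [b' [b'P b'Z]] := ZP g gP.
  apply: (@intr_inj rat); rewrite rmorphB /= bZ b'Z -mulrBr -eval_dB; apply: ZE.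
    apply/is_cocycle3P => x y z t; rewrite /cofun3_of.
    have := (is_cocycle3P f).1 fP x y z t; have := (is_cocycle3P g).1 gP x y z t.
    by rewrite /cofun3_of; lia.
  have [[bE bc] [b'E b'c]] := (bP, b'P); split; last by rewrite eval_cB bc b'c subrr.
  by move=> x y z; rewrite /cofun3_of rmorphB /= -/(cofun3_of f x y z)
    -/(cofun3_of g x y z) bE b'E; ring.
(* An integer lift [u] of [cup D] is a cocycle modulo 2, so half its coboundary is an integral
   3-cocycle, the Bockstein of the cup product. Its primitive [u / 2] has value 1/2 at d. *)
- move=> a; have [D [DM DS DU DX]] := exists_derivation.
  have cupP := cup_cocycle DM.
  pose u g h : int := (cup D g h : nat).
  have uE g h : (u g h)%:~R = cup D g h by rewrite /u -pmulrn natr_Zp.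
  pose du g h k := u h k - u (g * h)%g k + u g (h * k)%g - u g h.
  have du_even g h k : (du g h k %/ 2)%Z * 2 = du g h k.
    have /even_mod2[m ->] : (du g h k)%:~R = 0 :> 'Z_2.
      rewrite /du !(intrB, intrD) !uE; have := cupP g h k => e.
      by apply: (zmod_from e); zmod.
    by rewrite mulrC [2 * m]mulrC mulzK // mulrC.
  pose f := cochain3_of (fun g h k => (du g h k %/ 2)%Z * (a : nat)%:Z).
  pose b g h : rat := (u g h)%:~R / 2 * (a : nat)%:R.
  have fE g h k : cofun3_of f g h k = (du g h k %/ 2)%Z * (a : nat)%:Z by [].
  have bE g h k : (cofun3_of f g h k)%:~R =
      b h k - b (g * h)%g k + b g (h * k)%g - b g h.
    apply: (mulIf (_ : 2 != 0 :> rat)) => //.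
    have -> : (cofun3_of f g h k)%:~R * 2 = (du g h k)%:~R * (a : nat)%:R :> rat.
      by rewrite -(du_even g h k) fE !intrM -pmulrn; ring.
    by rewrite /du /b !(intrB, intrD); field.
  have fP : is_cocycle f.
    apply/is_cocycle3P => g h k l; apply: (@intr_inj rat).
    rewrite !intrD !bE -!mulgA; ring.
  have DY := D_translY DM DS DX.
  have [uXY uYX uXS] : [/\ u jX jY = 0, u jY jX = 0 & u jX jS = 1].
    by rewrite /u /cup DX DY DS !jcoord.
  have [uSY uXU uUY] : [/\ u jS jY = 0, u jX jU = 0 & u jU jY = 0].
    by rewrite /u /cup DU DY !jcoord.
  have bc : eval_c b = 0 by rewrite /eval_c /b uXY uYX subrr.
  have bd : 2 * eval_d b = (a : nat)%:R.
    by rewrite /eval_d /b uXS uSY uXU uUY; field.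
  exists f; split=> //.
  have : (Z f)%:~R = ((a : nat)%:Z)%:~R :> rat by rewrite (ZE f b) // bd.
  by move=> /intr_inj ->; rewrite -pmulrn natr_Zp.
move=> f fP; split.
  (* When [2 b(d)] is even, [b(d)] is an integer and [b] splits modulo Z; subtracting the coboundary
     of [v] leaves an integral cochain with the same coboundary as [b]. *)
  move=> /even_mod2[m Zm]; have [b [bP bZ]] := ZP f fP; have [bE bc] := bP.
  have [|||v vE] := @qz_split b.
  - move=> g h k; rewrite (_ : _ - b g h = (cofun3_of f g h k)%:~R) ?intr_int // bE; lra.
  - by rewrite bc.
  - rewrite (_ : eval_d b = m%:~R) ?intr_int //; move: bZ; rewrite Zm intrM; lra.
  pose c g h := projT1 (choice (fun h => elimT intrP (vE g h))) h.
  have cE g h : b g h - (v h - v (g * h)%g + v g) = (c g h)%:~R.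
    exact: projT2 (choice (fun h => elimT intrP (vE g h))) h.
  apply/is_coboundary3P; exists c => g h k; apply: (@intr_inj rat).
  rewrite bE !(intrB, intrD) -!cE -!mulgA; ring.
(* Conversely an integral [c], once normalized, is a primitive whose value at d is the integer
   [eval_d c]. *)
move=> /is_coboundary3P[c cE]; apply/even_mod2; exists (eval_d c).
have [|bP bd] := @primitive_normalize f (fun g h => (c g h)%:~R).
  by move=> g h k; rewrite cE !(intrB, intrD).
apply: (@intr_inj rat); rewrite (ZE _ _ fP bP) bd intrM; congr (_ * _).
by rewrite /eval_d !intrB.
Qed.

Theorem theorem4 :
  homology_iso 1 'Z_12 /\
  homology_iso 2 (int * 'Z_2)%type /\
  cohomology_trivial 1 /\
  cohomology_iso 2 (int * 'Z_12)%type /\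
  cohomology_iso 3 'Z_2.
Proof.
split; first exact: homology1.
split; first exact: homology2.
split; first exact: cohomology1.
by split; [exact: cohomology2 | exact: cohomology3].
Qed.
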